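(* Let $N=2n$ be even, let $0<a\le 1$ and $b=2-a$, and consider the biased random transpositions walk on $S_N$ described in the context. For every $\varepsilon\in(0,1)$, its separation mixing time $T(\varepsilon)$ satisfies $$\lim_{N\to\infty}\frac{2a\,T(\varepsilon)}{N\log N}=1 .$$
   Context: Biased random transpositions walk: there are $N=2n$ cards. A fixed set of $n$ of them are called $a$-cards and have weight $p(c)=a$; the other $n$ are $b$-cards and have weight $p(c)=b$, where $0<a\le 1$ and $b=2-a$. At each step $t=1,2,\dots$ two cards $R_t$ (''right hand'') and $L_t$ (''left hand'') are chosen independently, each equal to a given card $c$ with probability $p(c)/N$, and the positions of $R_t$ and $L_t$ are exchanged (nothing happens if $R_t=L_t$). Starting from the identity arrangement, let $P^t$ denote the distribution on $S_N$ of the arrangement after $t$ steps. This walk has the uniform distribution on $S_N$ as stationary distribution. The separation mixing time is $T(\varepsilon)=\min\{t:\ P^t(\sigma)\ge \frac{1-\varepsilon}{N!}\ \text{for all }\sigma\in S_N\}$. *)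

(* Defs.v *)
From mathcomp Require Import all_boot all_fingroup.
From Stdlib Require Import Reals.

Set Implicit Arguments.
Unset Strict Implicit.
Unset Printing Implicit Defensive.

(* Cards are 'I_(2*n); A is the set of a-cards (of size n in the theorem). *)

Definition weight (n : nat) (A : {set 'I_(2 * n)}) (a : R) (c : 'I_(2 * n)) : R :=
  if c \in A then a else (2 - a)%R.

Definition pick (n : nat) (A : {set 'I_(2 * n)}) (a : R) (c : 'I_(2 * n)) : R :=
  (weight A a c / INR (2 * n))%R.

(* An arrangement is a permutation sigma : cards -> positions.  One step with
   hands R = r, L = l exchanges the positions of cards r and l:
   new arrangement c |-> sigma (tperm r l c), i.e. (tperm r l * sigma)%g
   (mathcomp composes left to right).  If r = l, tperm r r = 1. *)
Definition step (n : nat) (s : {perm 'I_(2 * n)}) (r l : 'I_(2 * n))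
  : {perm 'I_(2 * n)} := (tperm r l * s)%g.

Fixpoint Pt (n : nat) (A : {set 'I_(2 * n)}) (a : R) (t : nat)
  : {perm 'I_(2 * n)} -> R :=
  match t with
  | 0 => fun s => if s == 1%g then 1%R else 0%R
  | t'.+1 => fun s =>
      \big[Rplus/0%R]_(s0 : {perm 'I_(2 * n)})
        \big[Rplus/0%R]_(r : 'I_(2 * n))
          \big[Rplus/0%R]_(l : 'I_(2 * n))
            (if step s0 r l == s
             then (Pt A a t' s0 * pick A a r * pick A a l)%R
             else 0%R)
  end.

Definition sep_ok (n : nat) (A : {set 'I_(2 * n)}) (a eps : R) (t : nat) : Prop :=
  forall s : {perm 'I_(2 * n)},
    (Pt A a t s >= (1 - eps) / INR ((2 * n)`!))%R.

Definition is_sep_mixing_time (n : nat) (A : {set 'I_(2 * n)}) (a eps : R)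
  (T : nat) : Prop :=
  sep_ok A a eps T /\ (forall t : nat, sep_ok A a eps t -> (T <= t)%coq_nat).

(* Main.v *)
(** In the group algebra, let [e_M] be the uniform measure on the permutations of
    a set [M] of cards.  A set [M] of "marked" cards grows because
    [\sum_(m in c |: M) tperm c m * e_M = #|M|.+1 * e_(c |: M)], whereas a single
    term [tperm c m * e_M = e_(c |: M :\ m) * tperm c m] replaces [m] by [c]; the
    excess weight of the heavy cards is spent on such replacements, which turn
    unmarked light cards into unmarked heavy ones.  With [C] large, the potential
    [(C * #unmarked a-cards + #unmarked b-cards) / #|M|] then contracts by
    [1 - 2 a (1 - d) / N] in every step, so that once a constant fraction of the
    cards is marked, [(1 + o(1)) N ln N / (2 a)] further steps suffice.

    A constant fraction is marked after [O(N)] steps.  Out of the walk one can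
    extract a constant proportion of steps of the uniform, hence central, walk.
    The expected number of cycles of the uniform walk moves by [-1 + 2 q], where
    [q] is the probability that two random cards share a cycle, and cannot become
    negative, so cycles of linear length occur.  By conjugation invariance they
    are uniform given their support, and the product of two uniform cycles on [M]
    dominates half the uniform measure on the even permutations of [M].  Finally
    the steps with [r = l] supply the odd permutations.  One such attempt succeeds
    with probability bounded below, and failed attempts are repeated.

    For the lower bound, if [t <= (1 - eta) N ln N / (2 a)] then by Chebyshev some
    a-card has with high probability not been touched and is fixed, while at least
    half of all permutations fix no a-card. *)
From Stdlib Require Import Reals ZArith Lra.

(** * Real asymptotics *)

Section Asymptotics.
Local Open Scope R_scope.

Lemma exp_mul_INR (z : R) (s : nat) : exp (z * INR s) = exp z ^ s.
Proof.
induction s as [|s IH].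
- simpl. rewrite Rmult_0_r. apply exp_0.
- rewrite S_INR, Rmult_plus_distr_l, Rmult_1_r, exp_plus, IH. simpl. ring.
Qed.

Lemma pow_le_exp (y : R) (s : nat) : 0 <= y <= 1 -> (1 - y) ^ s <= exp (- y * INR s).
Proof.
intros Hy.
rewrite exp_mul_INR. apply pow_incr. split; [lra|].
pose proof (exp_ineq1_le (- y)). lra.
Qed.

(** After inversion this is [1 / (1 - y) = 1 + y / (1 - y) <= exp (y / (1 - y))], raised to the
    power [s]. *)
Lemma exp_le_pow (y : R) (s : nat) : 0 <= y < 1 -> exp (- (y / (1 - y)) * INR s) <= (1 - y) ^ s.
Proof.
intros Hy.
rewrite exp_mul_INR. apply pow_incr. split; [left; apply exp_pos|].
rewrite exp_Ropp.
assert (H : / (1 - y) <= exp (y / (1 - y))).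
  pose proof (exp_ineq1_le (y / (1 - y))).
  replace (/ (1 - y)) with (1 + y / (1 - y)) by (field; lra). lra.
apply Rle_trans with (/ / (1 - y)); [|right; apply Rinv_inv].
apply Rinv_le_contravar; [|exact H]. apply Rinv_0_lt_compat. lra.
Qed.

Lemma ln_large (B : R) : exists X, 1 < X /\ forall x, X <= x -> B <= ln x.
Proof.
exists (exp (Rmax B 1)). split.
- apply Rle_lt_trans with (exp 0); [rewrite exp_0; lra|].
  apply exp_increasing. pose proof (Rmax_r B 1). lra.
- intros x Hx.
  apply Rle_trans with (Rmax B 1); [apply Rmax_l|].
  rewrite <- (ln_exp (Rmax B 1)).
  destruct Hx as [Hx| <-]; [|lra].
  left. apply ln_increasing; [apply exp_pos|exact Hx].
Qed.

Lemma nat_ceil (r : R) : 0 <= r -> exists s : nat, r <= INR s <= r + 1.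
Proof.
intros Hr. exists (Z.to_nat (up r)).
destruct (archimed r) as [H1 H2].
assert (Hz : (0 <= up r)%Z) by (apply le_IZR; lra).
rewrite INR_IZR_INZ, Z2Nat.id by exact Hz. lra.
Qed.

(** Time budget of the upper bound: [x] is the number of cards, [B * x] the length of the linear
    phase, [s] the number of steps contracting a potential of size at most [64 * C * x]. For [s]
    close to [(1 + eta / 2) x ln x / (2 a)] the exponential is at most [x ^ (-1 - eta / 8)]; the
    other [eta / 2] pays for [B * x] and for rounding. *)
Lemma upper_numeric (a e eta B C : R) : 0 < a <= 1 -> 0 < e -> 0 < eta <= 1 -> 0 <= B -> 0 < C ->
  exists X, forall x, X <= x -> exists s : nat,
    exp (- (2 * a * (1 - eta / 4) / x) * INR s) * (64 * C * x) <= e /\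
    B * x + INR s <= (1 + eta) * (x * ln x) / (2 * a).
Proof.
intros Ha He Heta HB HC.
destruct (ln_large (8 / eta * ln (64 * C / e))) as [X1 [HX1 H1]].
destruct (ln_large (2 * (2 * a) * (B + 1) / eta)) as [X2 [HX2 H2]].
exists (Rmax X1 X2). intros x Hx.
assert (Hx1 : X1 <= x) by (apply Rle_trans with (2 := Hx); apply Rmax_l).
assert (Hx2 : X2 <= x) by (apply Rle_trans with (2 := Hx); apply Rmax_r).
specialize (H1 x Hx1). specialize (H2 x Hx2).
assert (Hl : 0 < ln x) by (rewrite <- ln_1; apply ln_increasing; lra).
set (L := ln x) in *.
assert (Hr : 0 <= (1 + eta / 2) * (x * L) / (2 * a)).
  apply Rmult_le_pos; [|left; apply Rinv_0_lt_compat; lra].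
  apply Rmult_le_pos; [lra|]. apply Rmult_le_pos; lra.
destruct (nat_ceil _ Hr) as [s [Hs1 Hs2]].
exists s. split.
- assert (E1 : - (2 * a * (1 - eta / 4) / x) * INR s <= - (1 + eta / 8) * L). {
    apply Rle_trans with (- (2 * a * (1 - eta / 4) / x) * ((1 + eta / 2) * (x * L) / (2 * a))).
    + rewrite !Ropp_mult_distr_l_reverse. apply Ropp_le_contravar.
      apply Rmult_le_compat_l; [|exact Hs1].
      apply Rmult_le_pos; [|left; apply Rinv_0_lt_compat; lra].
      apply Rmult_le_pos; lra.
    + replace (- (2 * a * (1 - eta / 4) / x) * ((1 + eta / 2) * (x * L) / (2 * a)))
        with (- ((1 - eta / 4) * (1 + eta / 2)) * L) by (field; lra).
      (* [(1 - eta / 4) (1 + eta / 2) >= 1 + eta / 8] holds because [eta <= 1]. *)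
      apply Rmult_le_compat_r; [lra|]. nra. }
  assert (E2 : exp (- (1 + eta / 8) * L) * (64 * C * x) <= e). {
    replace (- (1 + eta / 8) * L) with (- L + - (eta / 8 * L)) by ring.
    rewrite exp_plus, exp_Ropp. unfold L at 1. rewrite exp_ln by lra.
    replace (/ x * exp (- (eta / 8 * L)) * (64 * C * x)) with (64 * C * exp (- (eta / 8 * L))) by (field; lra).
    assert (E3 : exp (- (eta / 8 * L)) <= e / (64 * C)).
      assert (Hp : 0 < 64 * C / e) by (apply Rdiv_lt_0_compat; lra).
      replace (e / (64 * C)) with (exp (- ln (64 * C / e))).
      2:{ rewrite exp_Ropp, exp_ln by exact Hp. field. lra. }
      assert (E4 : ln (64 * C / e) <= eta / 8 * L).
        replace (ln (64 * C / e)) with (eta / 8 * (8 / eta * ln (64 * C / e))) by (field; lra).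
        apply Rmult_le_compat_l; lra.
      destruct E4 as [E4|E4]; [left; apply exp_increasing; lra | rewrite E4; lra].
    apply Rle_trans with (64 * C * (e / (64 * C))).
    + apply Rmult_le_compat_l; lra.
    + right. field. lra. }
  apply Rle_trans with (2 := E2). apply Rmult_le_compat_r; [nra|].
  destruct E1 as [E1|E1]; [left; apply exp_increasing; exact E1 | rewrite E1; lra].
- assert (E : B * x + 1 <= eta / 2 * (x * L) / (2 * a)).
    apply Rle_trans with ((B + 1) * x); [lra|].
    replace (eta / 2 * (x * L) / (2 * a)) with (eta / (2 * (2 * a)) * L * x) by (field; lra).
    apply Rmult_le_compat_r; [lra|].
    replace (B + 1) with (eta / (2 * (2 * a)) * (2 * (2 * a) * (B + 1) / eta)) by (field; lra).
    apply Rmult_le_compat_l; [|exact H2].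
    left. apply Rdiv_lt_0_compat; lra.
  replace ((1 + eta) * (x * L) / (2 * a)) with
    ((1 + eta / 2) * (x * L) / (2 * a) + eta / 2 * (x * L) / (2 * a)) by (field; lra).
  lra.
Qed.

(** With [x / 2] a-cards, the product is the mean number of them untouched after [t] steps. It is at
    least [x ^ (eta / 2) / 2]. *)
Lemma lower_numeric (a eta c : R) : 0 < a <= 1 -> 0 < eta <= 1 -> 0 < c ->
  exists X, forall x (t : nat), X <= x -> INR t <= (1 - eta) * (x * ln x) / (2 * a) ->
    c < x / 2 * (1 - a / x) ^ (2 * t).
Proof.
intros Ha Heta Hc.
destruct (ln_large (2 / eta * (ln (2 * c) + 1))) as [X1 [HX1 H1]].
(* From [2 / eta <= x] one gets [eta * x >= 2], hence [(1 - eta) * x / (x - a) <= 1 - eta / 2]. *)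
exists (Rmax X1 (2 + 2 / eta)). intros x t Hx Ht.
assert (Hx1 : X1 <= x) by (apply Rle_trans with (2 := Hx); apply Rmax_l).
assert (Hx2 : 2 + 2 / eta <= x) by (apply Rle_trans with (2 := Hx); apply Rmax_r).
assert (He : 0 < 2 / eta) by (apply Rdiv_lt_0_compat; lra).
specialize (H1 x Hx1).
assert (Hl : 0 < ln x) by (rewrite <- ln_1; apply ln_increasing; lra).
set (L := ln x) in *.
assert (Hy : 0 <= a / x < 1).
  split; [left; apply Rdiv_lt_0_compat; lra|].
  apply Rmult_lt_reg_r with x; [lra|]. unfold Rdiv. rewrite Rmult_assoc, Rinv_l; lra.
apply Rlt_le_trans with (x / 2 * exp (- (a / x / (1 - a / x)) * INR (2 * t))).
2:{ apply Rmult_le_compat_l; [lra|]. apply exp_le_pow. exact Hy. }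
assert (E1 : - (1 - eta / 2) * L <= - (a / x / (1 - a / x)) * INR (2 * t)). {
  rewrite mult_INR. simpl (INR 2).
  replace (a / x / (1 - a / x)) with (a / (x - a)) by (field; lra).
  rewrite !Ropp_mult_distr_l_reverse. apply Ropp_le_contravar.
  apply Rle_trans with (a / (x - a) * (2 * ((1 - eta) * (x * L) / (2 * a)))).
  - apply Rmult_le_compat_l; [left; apply Rdiv_lt_0_compat; lra|]. lra.
  - replace (a / (x - a) * (2 * ((1 - eta) * (x * L) / (2 * a))))
      with ((1 - eta) * x / (x - a) * L) by (field; lra).
    apply Rmult_le_compat_r; [lra|].
    apply Rmult_le_reg_r with (x - a); [lra|].
    replace ((1 - eta) * x / (x - a) * (x - a)) with ((1 - eta) * x) by (field; lra).
    assert (E : 2 <= eta * x).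
      apply Rle_trans with (eta * (2 / eta)); [right; field; lra|].
      apply Rmult_le_compat_l; lra.
    nra. }
apply Rlt_le_trans with (x / 2 * exp (- (1 - eta / 2) * L)).
2:{ apply Rmult_le_compat_l; [lra|].
    destruct E1 as [E1|E1]; [left; apply exp_increasing; exact E1 | rewrite E1; lra]. }
replace (- (1 - eta / 2) * L) with (- L + eta / 2 * L) by field.
rewrite exp_plus, exp_Ropp. unfold L at 1. rewrite exp_ln by lra.
replace (x / 2 * (/ x * exp (eta / 2 * L))) with (exp (eta / 2 * L) / 2) by (field; lra).
assert (E2 : ln (2 * c) < eta / 2 * L). {
  apply Rlt_le_trans with (eta / 2 * (2 / eta * (ln (2 * c) + 1))).
  - replace (eta / 2 * (2 / eta * (ln (2 * c) + 1))) with (ln (2 * c) + 1) by (field; lra). lra.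
  - apply Rmult_le_compat_l; lra. }
apply exp_increasing in E2. rewrite exp_ln in E2 by lra. lra.
Qed.

Lemma pow_small (y e : R) : 0 <= y < 1 -> 0 < e -> exists K : nat, y ^ K <= e.
Proof.
intros Hy He. destruct (pow_lt_1_zero y) with (y := e) as [K HK]; [|exact He|].
- rewrite Rabs_pos_eq; lra.
- exists K. specialize (HK K (le_n K)). pose proof (Rle_abs (y ^ K)). lra.
Qed.

Lemma ratio_dist (a T y eta ep : R) : 0 < a -> 0 < y ->
  (1 - eta) * y / (2 * a) < T -> T <= (1 + eta) * y / (2 * a) -> eta < ep ->
  R_dist (2 * a * T / y) 1 < ep.
Proof.
intros Ha Hy H1 H2 He.
assert (E1 : 1 - eta < 2 * a * T / y).
{ replace (1 - eta) with (2 * a * ((1 - eta) * y / (2 * a)) / y) by (field; lra).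
  apply Rmult_lt_compat_r; [apply Rinv_0_lt_compat; lra|].
  apply Rmult_lt_compat_l; lra. }
assert (E2 : 2 * a * T / y <= 1 + eta).
{ replace (1 + eta) with (2 * a * ((1 + eta) * y / (2 * a)) / y) by (field; lra).
  apply Rmult_le_compat_r; [left; apply Rinv_0_lt_compat; lra|].
  apply Rmult_le_compat_l; lra. }
unfold R_dist. apply Rabs_def1; lra.
Qed.

End Asymptotics.

Require Import Defs.
From mathcomp Require Import all_boot all_order all_algebra all_fingroup.
From mathcomp Require Import ring lra zify.
From mathcomp Require Import boolp Rstruct.

Set Implicit Arguments.
Unset Strict Implicit.
Unset Printing Implicit Defensive.
Import Order.TTheory GRing.Theory Num.Theory.
Local Open Scope ring_scope.

(** * Transposition walks and uniformly arranged sets *)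

Section Walk.
Variables (R : realFieldType) (I : finType).
Implicit Types (p : I -> R) (u v : {perm I} -> R) (M : {set I}) (g h x : {perm I}).

(** The averaging operator of one step, acting on functions. As it is symmetric, its iterates at the
    indicator of the identity are the laws of the walk. *)
Definition walk p u g : R := \sum_r \sum_l p r * p l * u (tperm r l * g)%g.

Definition distr p := (forall i, 0 <= p i) /\ \sum_i p i = 1.

Lemma distr_pair p : distr p -> \sum_r \sum_l p r * p l = 1.
Proof.
case=> _ p1; under eq_bigr do rewrite -mulr_sumr p1 mulr1.
exact: p1.
Qed.

Lemma walk_le p u v g : (forall i, 0 <= p i) ->
  (forall x, u x <= v x) -> walk p u g <= walk p v g.
Proof.
move=> p0 uv; apply: ler_sum => r _; apply: ler_sum => l _.
by apply: ler_wpM2l => //; apply: mulr_ge0.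
Qed.

Lemma eq_walk p u v : u =1 v -> walk p u =1 walk p v.
Proof.
by move=> uv g; apply: eq_bigr => r _; apply: eq_bigr => l _; rewrite uv.
Qed.

Lemma walk_cst p m g : distr p -> walk p (fun=> m) g = m.
Proof.
move=> dp; rewrite /walk.
under eq_bigr do rewrite -mulr_suml.
by rewrite -mulr_suml distr_pair // mul1r.
Qed.

Lemma walk_ge p u m g : distr p -> (forall x, m <= u x) -> m <= walk p u g.
Proof.
move=> dp mu; rewrite -[X in X <= _](walk_cst m g dp).
by apply: walk_le => //; case: dp.
Qed.

Lemma iter_walk_ge p t u m g : distr p -> (forall x, m <= u x) ->
  m <= iter t (walk p) u g.
Proof. by move=> dp mu; elim: t g => //= t IH g; apply: walk_ge. Qed.

Lemma walkB p u m g : distr p ->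
  walk p (fun x => u x - m) g = walk p u g - m.
Proof.
move=> dp; rewrite -[in RHS](walk_cst m g dp) -sumrB.
apply: eq_bigr => r _; rewrite -sumrB; apply: eq_bigr => l _.
by rewrite mulrBr.
Qed.

Lemma iter_walkB p t u m g : distr p ->
  iter t (walk p) (fun x => u x - m) g = iter t (walk p) u g - m.
Proof.
move=> dp; elim: t g => //= t IH g.
by rewrite (eq_walk p IH) walkB.
Qed.

Lemma walk_selfadj p u v :
  \sum_g walk p u g * v g = \sum_g u g * walk p v g.
Proof.
rewrite /walk.
under eq_bigr do rewrite mulr_suml.
under [RHS]eq_bigr do rewrite mulr_sumr.
rewrite exchange_big [RHS]exchange_big; apply: eq_bigr => r _ /=.
under eq_bigr do rewrite mulr_suml.
under [RHS]eq_bigr do rewrite mulr_sumr.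
rewrite exchange_big [RHS]exchange_big; apply: eq_bigr => l _ /=.
rewrite (reindex_inj (mulgI (tperm r l))) /=; apply: eq_bigr => g _.
by rewrite mulgA tperm2 mul1g; ring.
Qed.

Lemma iter_walk_selfadj p t u v :
  \sum_g iter t (walk p) u g * v g = \sum_g u g * iter t (walk p) v g.
Proof.
elim: t u => // t IH u; rewrite iterSr IH walk_selfadj; exact: eq_bigr.
Qed.

Definition dirac g : R := (g == 1%g)%:R.

(** Steps multiply on the left and so commute with the right translation by [g]. *)
Lemma iter_walk_dirac p t u g :
  iter t (walk p) u g = \sum_x iter t (walk p) dirac x * u (x * g)%g.
Proof.
elim: t u => [|t IH] u.
  rewrite /= (bigD1 1%g) //= /dirac eqxx mul1r mul1g big1 ?addr0 // => x /negPf->.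
  by rewrite mul0r.
rewrite iterSr IH; under [RHS]eq_bigr do rewrite iterS.
rewrite (walk_selfadj p (iter t (walk p) dirac) (fun x => u (x * g)%g)).
apply: eq_bigr => x _; congr (_ * _); rewrite /walk.
by under eq_bigr do (under eq_bigr do rewrite mulgA).
Qed.

(** * Sums over the permutations of a marked set *)

Definition symsum (b : bool) M u g : R :=
  \sum_(h : {perm I} | perm_on M h && (b ==> ~~ odd_perm h)) u (h * g)%g.

Lemma perm_on_conj x M h : perm_on (x @^-1: M) (x * h * x^-1)%g = perm_on M h.
Proof.
apply/subsetP/subsetP => H y; rewrite !inE.
  move=> hy; have := H (x^-1 y)%g; rewrite !inE !permM permKV; apply.
  by apply: contra hy => /eqP /perm_inj ->.
rewrite !permM => xy; apply: H; rewrite inE.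
by apply: contra xy => /eqP ->; rewrite permK.
Qed.

(** Since [x * h = (x * h * x^-1) * x], the factor [x] can be moved past [h] if [M] is replaced by
    its preimage; conjugation keeps the parity. *)
Lemma symsum_transl b x M u g :
  \sum_(h : {perm I} | perm_on M h && (b ==> ~~ odd_perm h)) u (x * h * g)%g =
  symsum b (x @^-1: M) u (x * g)%g.
Proof.
have cI : injective (fun h => x * h * x^-1)%g by move=> h1 h2 /mulIg /mulgI.
rewrite /symsum [RHS](reindex_inj cI) /=; apply: eq_big => [h|h _].
  by rewrite perm_on_conj !odd_permM odd_permV addbC addbA addbb.
by rewrite -!mulgA mulKg.
Qed.

Lemma card_preim_perm x M : #|x @^-1: M| = #|M|.
Proof. by apply: on_card_preimset; exists (x^-1)%g => y _; rewrite ?permK ?permKV. Qed.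

Lemma symsum_walk p b M u g : symsum b M (walk p u) g =
  \sum_r \sum_l p r * p l * symsum b (tperm r l @^-1: M) u (tperm r l * g)%g.
Proof.
rewrite {1}/symsum /walk exchange_big; apply: eq_bigr => r _ /=.
rewrite exchange_big; apply: eq_bigr => l _ /=.
rewrite -symsum_transl mulr_sumr; apply: eq_bigr => h _.
by rewrite mulgA.
Qed.

(** For [b = false], [c] bounds from below the average of [u] over every coset of the symmetric
    group of every set with at least [k] elements. For [b = true] only even permutations are summed,
    but the normalisation is the same. *)
Definition mixing (b : bool) k (c : R) u := forall M g, (k <= #|M|)%N ->
  c * #|M|`!%:R <= symsum b M u g.

Lemma mixing_walk p b k c u : distr p -> mixing b k c u -> mixing b k c (walk p u).
Proof.
move=> dp H M g kM; rewrite symsum_walk.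
apply: (@le_trans _ _ (\sum_r \sum_l p r * p l * (c * #|M|`!%:R))).
  under eq_bigr do rewrite -mulr_suml.
  by rewrite -mulr_suml distr_pair ?mul1r.
case: dp => p0 _.
apply: ler_sum => r _; apply: ler_sum => l _; apply: ler_wpM2l; first exact: mulr_ge0.
by rewrite -(card_preim_perm (tperm r l) M) H // card_preim_perm.
Qed.

Lemma mixing_iter_walk p b k c u t : distr p -> mixing b k c u ->
  mixing b k c (iter t (walk p) u).
Proof. by move=> dp H; elim: t => //= t IH; apply: mixing_walk. Qed.

(** Coset decomposition: a permutation of [c |: M] is uniquely [tperm c m * h] with [h] on [M], and
    [m] is the point that it sends to [c]. *)
Lemma symsum_insert c M u g : c \notin M ->
  \sum_(m in c |: M) \sum_(h : {perm I} | perm_on M h && (false ==> ~~ odd_perm h))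
    u (tperm c m * h * g)%g = symsum false (c |: M) u g.
Proof.
move=> cM; rewrite /symsum [RHS](partition_big (fun h => h^-1 c)%g (mem (c |: M))) /=; last first.
  by move=> h /andP[hM _]; rewrite -(perm_closed _ hM) permKV setU11.
apply: eq_bigr => m mM; rewrite [RHS](reindex_inj (mulgI (tperm c m))) /=.
apply: eq_bigl => h; rewrite !andbT.
have tM : perm_on (c |: M) (tperm c m).
  apply: subset_trans (tperm_on _ _) _.
  by apply/subsetP => y; rewrite !inE => /orP[]/eqP->; rewrite ?eqxx //; move: mM; rewrite !inE.
apply/idP/andP => [hM|[thM /eqP hc]].
  split.
    by apply: perm_onM => //; apply: subset_trans hM _; apply: subsetUr.
  by apply/eqP; apply: (@perm_inj _ (tperm c m * h)%g); rewrite permKV permM tpermR (out_perm hM).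
have hM : perm_on (c |: M) h.
  by rewrite -[h](mulKg (tperm c m)) perm_onM // perm_onV.
have hcc : h c = c.
  by move/(congr1 (tperm c m * h)%g): hc; rewrite permKV permM tpermR.
apply/subsetP => y hy; have := subsetP hM y hy; rewrite !inE; case: eqP => // yc.
by move: hy; rewrite inE yc hcc eqxx.
Qed.

Lemma preim_tperm_in r l M : (r \in M) = (l \in M) -> tperm r l @^-1: M = M.
Proof. by move=> e; apply/setP => y; rewrite inE; case: tpermP => // ->. Qed.

Lemma preim_tperm_swap c m M : c \notin M -> m \in M ->
  tperm c m @^-1: M = (c |: M) :\ m.
Proof.
move=> cM mM; apply/setP => y; rewrite !inE; case: tpermP => [->|->|/eqP yc /eqP ym].
- by rewrite eqxx mM andbT; apply/esym; apply: contraNneq cM => ->.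
- by rewrite eqxx (negPf cM).
- by rewrite (negPf yc) ym.
Qed.

Lemma symsum_tperm_mem r l M u g : r \in M -> l \in M ->
  symsum false (tperm r l @^-1: M) u (tperm r l * g)%g = symsum false M u g.
Proof.
move=> rM lM; rewrite -symsum_transl /symsum.
rewrite [RHS](reindex_inj (mulgI (tperm r l))) /=; apply: eq_bigl => h.
have tM : perm_on M (tperm r l).
  by apply: subset_trans (tperm_on _ _) _; apply/subsetP => y; rewrite !inE => /orP[]/eqP->.
rewrite !andbT; apply/idP/idP => hM; first exact: perm_onM.
by rewrite -[h](mulKg (tperm r l)) perm_onM // perm_onV.
Qed.

(** * Averages over a marked set and their evolution *)

Definition symavg M u g : R := symsum false M u g / #|M|`!%:R.

Lemma fact_gt0R n : 0 < n`!%:R :> R. Proof. by rewrite ltr0n fact_gt0. Qed.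

Lemma symavg_walk p M u g : symavg M (walk p u) g =
  \sum_r \sum_l p r * p l * symavg (tperm r l @^-1: M) u (tperm r l * g)%g.
Proof.
rewrite /symavg symsum_walk mulr_suml; apply: eq_bigr => r _.
rewrite mulr_suml; apply: eq_bigr => l _.
by rewrite card_preim_perm mulrA.
Qed.

Lemma symavg_insert c M u g : c \notin M ->
  \sum_(m in M) symavg (tperm c m @^-1: M) u (tperm c m * g)%g =
  #|M|.+1%:R * symavg (c |: M) u g - symavg M u g.
Proof.
move=> cM; have := symsum_insert u g cM.
rewrite big_setU1 //= => E; rewrite /symavg cardsU1 cM add1n factS natrM.
have -> : symsum false (c |: M) u g = symsum false M u g + 
  \sum_(m in M) symsum false (tperm c m @^-1: M) u (tperm c m * g)%g.
  rewrite -E; congr (_ + _); first by apply: eq_bigr => h _; rewrite tperm1 mul1g.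
  by apply: eq_bigr => m _; rewrite -symsum_transl.
under eq_bigr do rewrite card_preim_perm.
rewrite -mulr_suml; have f0 := fact_gt0R #|M|.
have k0 : (#|M|.+1%:R : R) != 0 by rewrite pnatr_eq0.
move: (#|M|.+1%:R : R) k0 (#|M|`!%:R : R) f0 => K K0 F F0.
by field; rewrite K0 lt0r_neq0.
Qed.

(* [x c] is the rate at which [c] is marked through each [m]; the remaining
   weight of the pair [(c, m)] exchanges the roles of [c] and [m]. *)
Lemma symavg_walk_ge p M u g (x : I -> R) (lo : {set I} -> R) : distr p ->
  (forall c, 0 <= x c) ->
  (forall c m, c \notin M -> m \in M -> x c <= 2 * p c * p m) ->
  \sum_(c in ~: M) x c <= (\sum_(m in M) p m) ^+ 2 ->
  (forall M' g', (#|M| <= #|M'|)%N -> lo M' <= symavg M' u g') ->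
  lo M + \sum_(c in ~: M) x c * #|M|.+1%:R * (lo (c |: M) - lo M)
    + \sum_(c in ~: M) \sum_(m in M)
        (2 * p c * p m - x c) * (lo ((c |: M) :\ m) - lo M)
  <= symavg M (walk p u) g.
Proof.
move=> dp x0 xp xs Hlo; have [p0 p1] := dp; rewrite symavg_walk.
pose F r l := symavg (tperm r l @^-1: M) u (tperm r l * g)%g.
have FC r l : F r l = F l r by rewrite /F tpermC.
rewrite -/(F _ _).
(* Pairs of hands are sorted into both marked, both unmarked, and one of each kind in either
   order. *)
have split2 (G : I -> I -> R) : \sum_r \sum_l G r l =
  \sum_(r in M) \sum_(l in M) G r l + \sum_(r in ~: M) \sum_(l in ~: M) G r l
  + \sum_(c in ~: M) \sum_(m in M) (G c m + G m c).
  have spl (H : I -> R) : \sum_r H r = \sum_(r in M) H r + \sum_(r in ~: M) H r.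
    by rewrite (bigID (mem M)) /=; congr (_ + _); apply: eq_bigl => r; rewrite inE.
  rewrite spl; under eq_bigr do rewrite spl.
  under [X in _ + X]eq_bigr do rewrite spl.
  rewrite !big_split /= [X in (_ + X) + _ = _]exchange_big /=.
  under [X in _ = _ + X]eq_bigr do rewrite big_split /=.
  by rewrite big_split /=; lra.
have HM : \sum_(r in M) \sum_(l in M) p r * p l * F r l =
   (\sum_(m in M) p m) ^+ 2 * symavg M u g.
  rewrite expr2 !mulr_suml; apply: eq_bigr => r rM.
  rewrite mulr_sumr mulr_suml; apply: eq_bigr => l lM.
  rewrite /F /symavg symsum_tperm_mem // card_preim_perm; lra.
have HC : (\sum_(c in ~: M) p c) ^+ 2 * lo M <=
    \sum_(r in ~: M) \sum_(l in ~: M) p r * p l * F r l.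
  rewrite expr2 !mulr_suml; apply: ler_sum => r rM.
  rewrite mulr_sumr mulr_suml; apply: ler_sum => l lM.
  move: rM lM; rewrite !inE => /negPf rM /negPf lM.
  apply: ler_wpM2l; first exact: mulr_ge0.
  by rewrite /F preim_tperm_in ?rM ?lM // Hlo.
have HX : \sum_(c in ~: M) \sum_(m in M) (p c * p m * F c m + p m * p c * F m c) =
  \sum_(c in ~: M) x c * (#|M|.+1%:R * symavg (c |: M) u g - symavg M u g) +
  \sum_(c in ~: M) \sum_(m in M) (2 * p c * p m - x c) * F c m.
  rewrite -big_split; apply: eq_bigr => c /=; rewrite inE => cM.
  rewrite -symavg_insert // mulr_sumr -big_split; apply: eq_bigr => m mM /=.
  by rewrite [F m c]FC -/(F c m); ring.
rewrite split2 HM HX.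
have S1 : \sum_(m in M) p m + \sum_(c in ~: M) p c = 1.
  rewrite -p1 [RHS](bigID (mem M)) /=; congr (_ + _).
  by apply: eq_bigl => r; rewrite inE.
have G1 : \sum_(c in ~: M) x c * (#|M|.+1%:R * symavg (c |: M) u g - symavg M u g) >=
  \sum_(c in ~: M) x c * #|M|.+1%:R * lo (c |: M) - (\sum_(c in ~: M) x c) * symavg M u g.
  rewrite mulr_suml -sumrB; apply: ler_sum => c; rewrite inE => cM.
  rewrite -mulrA -mulrBr; apply: ler_wpM2l => //; apply: lerB => //.
  apply: ler_wpM2l => //; apply: Hlo; rewrite cardsU1 cM; lia.
have G2 : \sum_(c in ~: M) \sum_(m in M) (2 * p c * p m - x c) * F c m >=
  \sum_(c in ~: M) \sum_(m in M) (2 * p c * p m - x c) * lo ((c |: M) :\ m).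
  apply: ler_sum => c; rewrite inE => cM; apply: ler_sum => m mM.
  apply: ler_wpM2l; first by rewrite subr_ge0 xp.
  by rewrite -preim_tperm_swap // Hlo // card_preim_perm.
(* The average over [M] itself has as coefficient the squared marked weight minus the sum of the
   [x c]. The hypothesis on that sum makes it nonnegative, so that [lo M] may replace the
   average. *)
have G3 : ((\sum_(m in M) p m) ^+ 2 - \sum_(c in ~: M) x c) * lo M <=
          ((\sum_(m in M) p m) ^+ 2 - \sum_(c in ~: M) x c) * symavg M u g.
  by apply: ler_wpM2l; [rewrite subr_ge0 | rewrite Hlo].
have E1 : \sum_(c in ~: M) x c * #|M|.+1%:R * (lo (c |: M) - lo M) =
  \sum_(c in ~: M) x c * #|M|.+1%:R * lo (c |: M) -
  (\sum_(c in ~: M) x c) * #|M|.+1%:R * lo M.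
  by rewrite !mulr_suml -sumrB; apply: eq_bigr => c _; rewrite mulrBr.
have E2 : \sum_(c in ~: M) \sum_(m in M) (2 * p c * p m - x c) * (lo ((c |: M) :\ m) - lo M) =
  \sum_(c in ~: M) \sum_(m in M) (2 * p c * p m - x c) * lo ((c |: M) :\ m) -
  (2 * (\sum_(c in ~: M) p c) * (\sum_(m in M) p m) - #|M|%:R * \sum_(c in ~: M) x c) * lo M.
  have -> : 2 * (\sum_(c in ~: M) p c) * (\sum_(m in M) p m) - #|M|%:R * (\sum_(c in ~: M) x c)
     = \sum_(c in ~: M) \sum_(m in M) (2 * p c * p m - x c).
    rewrite [2 * _]mulr_sumr mulr_suml [#|M|%:R * _]mulr_sumr -sumrB.
    apply: eq_bigr => c _.
    by rewrite sumrB sumr_const -mulr_sumr !mulr_natl.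
  rewrite mulr_suml -sumrB; apply: eq_bigr => c _.
  rewrite mulr_suml -sumrB; apply: eq_bigr => m _.
  by rewrite mulrBr.
rewrite E1 E2.
have -> : \sum_(c in ~: M) p c = 1 - \sum_(m in M) p m by lra.
rewrite (_ : \sum_(c in ~: M) p c = 1 - \sum_(m in M) p m) in HC; last by lra.
rewrite -[#|M|.+1%:R]natr1 in G1 *.
move: (\sum_(m in M) p m) (\sum_(c in ~: M) x c) HC G1 G2 G3 => P X HC G1 G2 G3.
lra.
Qed.

(** Lyapunov argument: the left-hand side serves as [lo] in the one-step bound, and the drift
    condition carries it from [t] to [t + 1]. At time 0 it is nonpositive unless all cards are
    marked, and then [V] vanishes. Marked sets never shrink, so [k <= #|M|] persists. *)
Lemma iter_walk_symavg_ge p (V : {set I} -> R) (x : {set I} -> I -> R) k rho t M g : distr p ->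
  (forall M c, 0 <= x M c) ->
  (forall M c m, (k <= #|M|)%N -> c \notin M -> m \in M -> x M c <= 2 * p c * p m) ->
  (forall M, (k <= #|M|)%N -> \sum_(c in ~: M) x M c <= (\sum_(m in M) p m) ^+ 2) ->
  (forall M, 0 <= V M) -> V [set: I] = 0 -> (forall M, M != [set: I] -> (k <= #|M|)%N -> 1 <= V M) ->
  0 <= rho ->
  (forall M, (k <= #|M|)%N ->
     \sum_(c in ~: M) x M c * #|M|.+1%:R * (V M - V (c |: M))
   + \sum_(c in ~: M) \sum_(m in M)
        (2 * p c * p m - x M c) * (V M - V ((c |: M) :\ m)) >= (1 - rho) * V M) ->
  (k <= #|M|)%N ->
  (1 - rho ^+ t * V M) / #|I|`!%:R <= symavg M (iter t (walk p) dirac) g.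
Proof.
move=> dp x0 xp xs V0 VT V1 rho0 drift.
have f0 := fact_gt0R #|I|.
elim: t M g => [|t IH] M g kM.
  rewrite expr0 mul1r /=; have [->|MT] := eqVneq M [set: I].
    rewrite VT subr0 /symavg cardsT; apply: ler_wpM2r; first by rewrite invr_ge0 ltW.
    rewrite /symsum (bigD1 (g^-1)%g) /=; last by rewrite andbT; apply/subsetP.
    rewrite /dirac mulVg eqxx lerDl; apply: sumr_ge0 => h _; exact: ler0n.
  apply: (@le_trans _ _ 0).
    by rewrite pmulr_lle0 ?invr_gt0 // subr_le0 V1.
  by apply: mulr_ge0; [apply: sumr_ge0 => h _; apply: ler0n | rewrite invr_ge0 ler0n].
set y := rho ^+ t in IH; pose lo M := (1 - y * V M) / #|I|`!%:R.
have y0 : 0 <= y by apply: exprn_ge0.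
apply: le_trans (@symavg_walk_ge p M _ g (x M) lo dp _ _ _ _) => //; last first.
- by move=> M' g' MM'; apply: IH; apply: leq_trans MM'.
- exact: xs.
- by move=> c m; apply: xp.
have dlo M1 : lo M1 - lo M = y / #|I|`!%:R * (V M - V M1).
  by rewrite /lo; field; apply: lt0r_neq0.
have D : y / #|I|`!%:R * ((1 - rho) * V M) <= y / #|I|`!%:R * (\sum_(c in ~: M) x M c * #|M|.+1%:R * (V M - V (c |: M))
   + \sum_(c in ~: M) \sum_(m in M)
        (2 * p c * p m - x M c) * (V M - V ((c |: M) :\ m))).
  by apply: ler_wpM2l; [apply: divr_ge0 => //; apply: ltW | apply: drift].
rewrite mulrDr !mulr_sumr in D.
have -> : \sum_(c in ~: M) x M c * #|M|.+1%:R * (lo (c |: M) - lo M) =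
  \sum_(i in ~: M) y / #|I|`!%:R * (x M i * #|M|.+1%:R * (V M - V (i |: M))).
  by apply: eq_bigr => c _; rewrite dlo; ring.
have -> : \sum_(c in ~: M) \sum_(m in M)
      (2 * p c * p m - x M c) * (lo ((c |: M) :\ m) - lo M) =
   \sum_(i in ~: M) y / #|I|`!%:R *
        (\sum_(m in M) (2 * p i * p m - x M i) * (V M - V ((i |: M) :\ m))).
  apply: eq_bigr => c _; rewrite mulr_sumr; apply: eq_bigr => m _.
  by rewrite dlo; ring.
rewrite -addrA; apply: le_trans (lerD (lexx _) D).
rewrite exprS -/y /lo le_eqVlt; apply/orP; left; apply/eqP; field; exact: lt0r_neq0.
Qed.

End Walk.

(** * Products of two long cycles *)

Section Cycles.
Variables (R : realFieldType) (I : finType).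
Implicit Types (x c r h : {perm I}) (s Z : seq I) (M : {set I}).

Lemma porbit_sub_stable x w (S : {set I}) :
  w \in S -> (forall y, y \in S -> x y \in S) -> porbit x w \subset S.
Proof.
move=> wS xS; apply/subsetP => y /porbitP[i ->]; elim: i => [|i IH].
  by rewrite expg0 perm1.
by rewrite expgSr permM xS.
Qed.

Lemma porbit_stable x w y : y \in porbit x w -> x y \in porbit x w.
Proof. by case/porbitP => i ->; rewrite -permM -expgSr mem_porbit. Qed.

(** Multiplying by [tperm z j] on the left inserts the fixed point [z] into the cycle of [j],
    directly after [j]. *)
Lemma porbit_insert x z j w : x z = z -> z != w -> j != z ->
  porbit (tperm z j * x) w =
    if j \in porbit x w then z |: porbit x w else porbit x w.
Proof.
move=> xz zw jz; set y := (tperm z j * x)%g.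
have yz : y z = x j by rewrite permM tpermL.
have yj : y j = z by rewrite permM tpermR.
have yE a : a != z -> a != j -> y a = x a.
  by move=> az aj; rewrite permM tpermD // eq_sym.
have wz : w != z by rewrite eq_sym.
have zx : z \notin porbit x w.
  apply/negP => /porbitP[i E]; case/eqP: zw.
  apply: (@perm_inj _ (x ^+ i)%g); rewrite -E.
  by elim: (i) => [|k IH]; rewrite ?expg0 ?perm1 // expgSr permM IH.
case: ifP => jx; last first.
  have E i : (y ^+ i)%g w = (x ^+ i)%g w.
    elim: i => [|i IH]; first by rewrite !expg0.
    rewrite !expgSr permM IH yE ?permM //; first by apply: contraNneq zx => <-; exact: mem_porbit.
    by apply: contraFneq jx => <-; exact: mem_porbit.
  by apply/setP => a; apply/porbitP/porbitP => -[i ->]; exists i.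
have xsub : porbit x w \subset porbit y w :\ z.
  apply: porbit_sub_stable; first by rewrite !inE wz porbit_id.
  move=> a; rewrite !inE => /andP[az ay].
  have -> : x a != z by apply: contra az => /eqP xaz; apply/eqP/(@perm_inj _ x); rewrite xaz xz.
  have [aj|aj] := eqVneq a j; last by rewrite -yE //= porbit_stable.
  by rewrite aj -yz -yj; do 2!apply: porbit_stable; rewrite -aj.
apply/eqP; rewrite eqEsubset; apply/andP; split.
  apply: porbit_sub_stable; first by rewrite !inE porbit_id orbT.
  move=> a; rewrite !inE; have [->|az] /= := eqVneq a z.
    by rewrite yz porbit_stable // orbT.
  have [->|aj] := eqVneq a j; first by rewrite yj eqxx.
  by move=> ax; rewrite yE // porbit_stable ?orbT.
rewrite subUset sub1set; apply/andP; split; last first.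
  by apply: subset_trans xsub _; apply: subsetDl.
by rewrite -yj porbit_stable //; have := subsetP xsub j jx; rewrite !inE => /andP[].
Qed.

(** * Cyclic permutations built by insertion *)

Definition fixes Z x := all (fun z => x z == z) Z.

Variable x0 : I.

(* The [(size s)`!] cyclic permutations of [x0 :: s]: the head of [s] is
   inserted right after an arbitrary element of a cycle on the rest. *)
Fixpoint cycs s : seq {perm I} :=
  if s is z :: s' then [seq (tperm z j * c)%g | c <- cycs s', j <- x0 :: s']
  else [:: 1%g].

Lemma size_cycs s : size (cycs s) = (size s)`!.
Proof. by elim: s => // z s IH; rewrite [size _]size_allpairs IH /= factS mulnC. Qed.

Lemma sum_cycs_cons z s (G : {perm I} -> R) :
  \sum_(c <- cycs (z :: s)) G c =
  \sum_(c <- cycs s) \sum_(j <- x0 :: s) G (tperm z j * c)%g.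
Proof. exact: big_allpairs_dep. Qed.

Lemma cycs_on s c : c \in cycs s -> perm_on [set y in x0 :: s] c.
Proof.
elim: s c => [|z s IH] c; first by rewrite inE => /eqP->; exact: perm_on1.
case/allpairsP => -[c1 j] /= [c1s js ->].
have sub : [set y in x0 :: s] \subset [set y in x0 :: z :: s].
  by apply/subsetP => y; rewrite !inE => /orP[->|->]; rewrite ?orbT.
apply: perm_onM; last by apply: subset_trans (IH _ c1s) sub.
apply: subset_trans (tperm_on _ _) _; apply/subsetP => y.
rewrite in_set2 => /orP[]/eqP->; first by rewrite !inE eqxx orbT.
by apply: (subsetP sub); rewrite inE.
Qed.

(** As [c] fixes [z], [tperm z j * c = c * tperm z (c j)], and [c] permutes [x0 :: s]. *)
Lemma sum_cycs_consR z s (G : {perm I} -> R) : uniq (x0 :: z :: s) ->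
  \sum_(c <- cycs (z :: s)) G c =
  \sum_(c <- cycs s) \sum_(j <- x0 :: s) G (c * tperm z j)%g.
Proof.
move=> us; rewrite sum_cycs_cons; apply: eq_big_seq => c cs.
have us' : uniq (x0 :: s).
  by move: us; rewrite /= inE negb_or => /andP[/andP[_ ->] /andP[]].
have zs : z \notin x0 :: s.
  by move: us => /= /andP[]; rewrite !inE !negb_or eq_sym => /andP[->_]/andP[->].
rewrite !big_uniq // [RHS](reindex_inj (@perm_inj _ c)) /=.
apply: eq_big => [j|j _].
  by have := perm_closed j (cycs_on cs); rewrite !inE.
have cz : c z = z by apply: (out_perm (cycs_on cs)); rewrite inE.
by rewrite -{2}cz -tpermJ conjgE mulVKg.
Qed.

Lemma porbit_cycs s c r : uniq (x0 :: s) -> fixes (x0 :: s) r -> c \in cycs s ->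
  porbit (c * r)%g x0 = [set y in x0 :: s].
Proof.
elim: s c => [|z s IH] c us fr.
  rewrite inE => /eqP->; rewrite mul1g; apply/setP => y; rewrite !inE.
  have rx : r x0 = x0 by move: fr => /= /andP[/eqP].
  apply/porbitP/eqP => [[i ->]|->]; last by exists 0%N; rewrite expg0 perm1.
  by elim: i => [|i IH]; rewrite ?expg0 ?perm1 // expgSr permM IH.
case/allpairsP => -[c1 j] /= [c1s js ->].
move: us => /=; rewrite inE negb_or => /andP[/andP[xz xs] /andP[zs us]].
move: fr => /= /and3P[fx /eqP fz fs].
have zj : j != z by apply: contraTneq js => ->; rewrite inE negb_or eq_sym xz.
have IH1 := IH c1 _ _ c1s.
have c1z : (c1 * r)%g z = z.
  rewrite permM (out_perm (cycs_on c1s)) //.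
  by rewrite !inE negb_or eq_sym xz.
rewrite -mulgA porbit_insert // ?(eq_sym z) // IH1 /= ?xs ?us ?fx ?fs // ifT ?inE //.
by apply/setP => y; rewrite !inE orbCA.
Qed.

(** The conjugator [y1] of the shorter cycles is preceded by a power of [c1 * r], which commutes
    with [c1 * r] and rotates the insertion point [j] so that [y1] takes it to [k]. The first two
    properties of [y] serve the induction: they fix the next inserted point and preserve the
    cycle. *)
Lemma cycs_conj s c c' r : uniq (x0 :: s) -> fixes (x0 :: s) r ->
  c \in cycs s -> c' \in cycs s ->
  exists y : {perm I}, [/\ forall w, w \notin x0 :: s -> r w = w -> y w = w,
     forall w, (y w \in x0 :: s) = (w \in x0 :: s) & ((c * r) ^ y = c' * r)%g].
Proof.
elim: s c c' => [|z s IH] c c' us fr.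
  rewrite !inE => /eqP-> /eqP->; exists 1%g; rewrite conjg1.
  by split=> // w; rewrite perm1.
move=> /allpairsP[[c1 j] [c1s js ->]] /allpairsP[[c2 k] [c2s ks ->]].
move: c1s js c2s ks => /= c1s js c2s ks.
move: us => /=; rewrite inE negb_or => /andP[/andP[xz xs] /andP[zs us]].
move: fr => /= /and3P[fx /eqP fz fs].
have us' : uniq (x0 :: s) by rewrite /= xs us.
have fr' : fixes (x0 :: s) r by rewrite /= fx fs.
have zs' : z \notin x0 :: s by rewrite inE negb_or eq_sym xz.
have [y1 [y1f y1s y1c]] := IH c1 c2 us' fr' c1s c2s.
have Y := porbit_cycs us' fr' c1s.
have [i yi] : exists i, y1 (((c1 * r) ^+ i)%g j) = k.
  have jY : j \in porbit (c1 * r)%g x0 by rewrite Y inE.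
  have : (y1^-1)%g k \in porbit (c1 * r)%g x0 by rewrite Y inE -y1s permKV.
  rewrite -eq_porbit_mem in jY; rewrite -(eqP jY) => /porbitP[i E].
  by exists i; rewrite -E permKV.
have c1r_out w : w \notin x0 :: s -> r w = w -> ((c1 * r) ^+ i)%g w = w.
  move=> ws rw; elim: (i) => [|q IHq]; first by rewrite expg0 perm1.
  by rewrite expgSr permM IHq permM (out_perm (cycs_on c1s)) ?inE.
have c1r_in w : (((c1 * r) ^+ i)%g w \in x0 :: s) = (w \in x0 :: s).
  have := porbit_perm (c1 * r)%g i w; have:= Y; move/setP => Y'.
  have := Y' w; have := Y' (((c1 * r) ^+ i)%g w); rewrite !inE => <- <- E.
  by rewrite -!eq_porbit_mem E.
have z0 : y1 z = z by apply: y1f.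
exists ((c1 * r) ^+ i * y1)%g; split=> [w||].
- rewrite inE negb_or => /andP[wx]; rewrite inE negb_or => /andP[wz ws] rw.
  have w' : w \notin x0 :: s by rewrite inE negb_or wx.
  by rewrite permM c1r_out // y1f.
- move=> w; rewrite permM; have [->|wz] := eqVneq w z.
    by rewrite c1r_out // z0.
  have := y1s (((c1 * r) ^+ i)%g w); rewrite c1r_in !inE => E.
  have -> : (y1 (((c1 * r) ^+ i)%g w) == z) = false.
    apply/negP => /eqP E1; move: wz; rewrite -(inj_eq (@perm_inj _ ((c1 * r) ^+ i)%g)).
    rewrite -(inj_eq (@perm_inj _ y1)) E1 c1r_out // z0 eqxx //.
  by rewrite (negPf wz) /=.
rewrite -!mulgA conjMg tpermJ; congr (_ * _)%g; last first.
  by rewrite conjgM (_ : (c1 * r) ^ ((c1 * r) ^+ i) = c1 * r)%g // conjgE -expgS expgSr mulKg.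
by rewrite !permM c1r_out // z0 yi.
Qed.


Lemma porbit1P x w : (porbit x w == [set w]) = (x w == w).
Proof.
apply/eqP/eqP => [E|xw].
  by apply/set1P; rewrite -E porbit_stable // porbit_id.
apply/eqP; rewrite eqEsubset sub1set porbit_id andbT.
apply: porbit_sub_stable; first by rewrite inE.
by move=> y /set1P ->; rewrite xw inE.
Qed.

(** A permutation splits uniquely into its cycle through [x0] and a permutation of the other points.
    The induction turns the cycle point [z] into a fixed point, which is why a list [Z] of fixed
    points is carried along. *)
Lemma sum_porbit s Z (H : {perm I} -> R) : uniq (x0 :: s ++ Z) ->
  \sum_(x : {perm I} | (porbit x x0 == [set y in x0 :: s]) && fixes Z x) H x =
  \sum_(c <- cycs s) \sum_(r : {perm I} | fixes (x0 :: s ++ Z) r) H (c * r)%g.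
Proof.
elim: s Z H => [|z s IH] Z H us.
  rewrite big_seq1; apply: eq_big => [x|x _]; last by rewrite mul1g.
  have -> : [set y in [:: x0]] = [set x0] by apply/setP => y; rewrite !inE.
  by rewrite porbit1P.
have us' : uniq (x0 :: s ++ z :: Z).
  rewrite -(@perm_uniq _ (x0 :: (z :: s) ++ Z)) //.
  by apply/seq.permP => q; rewrite /= !count_cat /=; lia.
have [xz xs zs zZ] : [/\ x0 != z, x0 \notin s, z \notin s & z \notin Z].
  move: us; rewrite /= inE !mem_cat !negb_or.
  by case/andP => /and3P[-> -> _] /andP[/andP[-> ->]].
have us1 : uniq (x0 :: s).
  by move: us'; rewrite -cat_cons cat_uniq => /and3P[].
have zs1 : z \notin x0 :: s by rewrite inE negb_or eq_sym xz.
have jZ j : j \in x0 :: s -> j \notin Z.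
  move=> js; apply/negP => jZ; move: us; rewrite -cat_cons cat_uniq => /and3P[_ /hasPn /(_ _ jZ)].
  by rewrite !inE; move: js; rewrite inE => /orP[->|->]; rewrite ?orbT.
rewrite sum_cycs_cons.
rewrite [RHS]exchange_big /=.
(* Here [j] is the predecessor of [z] on the cycle, after which [z] was inserted. *)
rewrite [LHS](partition_big (fun x => x^-1 z)%g (fun j => j \in x0 :: s)) /=; last first.
  move=> x /andP[/eqP xY _].
  have zY : z \in porbit x x0 by rewrite xY !inE eqxx orbT.
  have : (x^-1 z)%g \in porbit x x0.
    by rewrite -porbitV; apply: porbit_stable; rewrite porbitV.
  rewrite xY !inE => /or3P[->//|/eqP E|->]; last by rewrite orbT.
  have xz' : x z = z by rewrite -{1}E permKV.
  have : porbit x z == [set z] by rewrite porbit1P xz'.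
  have : porbit x x0 = porbit x z by apply/eqP; rewrite eq_porbit_mem porbit_sym.
  move=> <- /eqP /setP /(_ x0); rewrite porbit_id inE => /esym E0.
  by rewrite E0 in xz.
rewrite -big_uniq //; apply: eq_big_seq => j js.
rewrite (reindex_inj (mulgI (tperm z j))) /=.
have jz : j != z by apply: contraTneq js => ->.
transitivity (\sum_(x : {perm I} | (porbit x x0 == [set y in x0 :: s]) && fixes (z :: Z) x)
   H (tperm z j * x)%g); last first.
  rewrite IH //; apply: eq_bigr => c _; apply: eq_big => [r|r _]; last by rewrite mulgA.
  by rewrite /fixes /= !all_cat /=; congr (_ && _); rewrite andbCA.
apply: eq_bigl => x /=.
have tE : (((tperm z j * x)^-1)%g z == j) = (x z == z).
  apply/eqP/eqP => E.
    by move/(congr1 (tperm z j * x)%g): E; rewrite permKV permM tpermR.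
  by apply: (@perm_inj _ (tperm z j * x)%g); rewrite permKV permM tpermR.
rewrite tE; have [xzz|_] := eqVneq (x z) z; rewrite ?andbF // andbT.
have -> : fixes Z (tperm z j * x)%g = fixes Z x.
  apply: eq_in_all => w wZ; rewrite permM tpermD //; first by apply: contraNneq zZ => ->.
  by apply: contraTneq wZ => <-; apply: jZ.
rewrite /=; congr (_ && _); rewrite porbit_insert //; last by rewrite eq_sym.
have zx : z \notin porbit x x0.
  apply/negP => zx; have : porbit x z == [set z] by rewrite porbit1P xzz.
  have <- : porbit x x0 = porbit x z by apply/eqP; rewrite eq_porbit_mem porbit_sym.
  by move=> /eqP /setP /(_ x0); rewrite porbit_id inE => /esym E0; rewrite E0 in xz.
have jin : j \in [set y in x0 :: z :: s] by move: js; rewrite !inE => /orP[->|->]; rewrite ?orbT.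
case: ifP => jx; apply/eqP/eqP => E.
- apply/setP => y; have /setP/(_ y) := E; rewrite !inE.
  have [->|yz] := eqVneq y z; last by [].
  by rewrite (negPf zx) (negPf zs) orbF eq_sym (negPf xz).
- by apply/setP => y; rewrite E !inE orbCA.
- by move: jx; rewrite E jin.
- by move: jx; rewrite E inE js.
Qed.

(** For [j != k] the products run over the even permutations of [z |: M] sending [k] to [z], so each
    one moving [z] is counted [#|M| - 1] times in all. The terms with [j = k] count those fixing [z]
    even [#|M|] times. *)
Lemma even_insert z M (G : {perm I} -> R) : z \notin M ->
  (forall x, 0 <= G x) ->
  (#|M| - 1)%:R * \sum_(h : {perm I} | perm_on (z |: M) h && ~~ odd_perm h) G h <=
  \sum_(j in M) \sum_(k in M) \sum_(h : {perm I} | perm_on M h && ~~ odd_perm h)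
     G (tperm z j * tperm z k * h)%g.
Proof.
move=> zM G0; pose A (h : {perm I}) := perm_on (z |: M) h && ~~ odd_perm h.
pose B (h : {perm I}) := perm_on M h && ~~ odd_perm h.
have BE h : B h = A h && (h z == z).
  rewrite /A /B; apply/andP/andP => [[hM eh]|[/andP[hM eh] /eqP hz]].
    by rewrite eh (out_perm hM) //= eqxx !andbT; split=> //; apply: subset_trans hM (subsetUr _ _).
  split=> //; apply/subsetP => y hy; have := subsetP hM y hy; rewrite !inE => /orP[/eqP yz|//].
  by move: hy; rewrite yz inE hz eqxx.
have tA j : j \in M -> perm_on (z |: M) (tperm z j).
  move=> jM; apply: subset_trans (tperm_on _ _) _.
  by apply/subsetP => y; rewrite !inE => /orP[]/eqP->; rewrite ?eqxx ?jM ?orbT.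
have step j k : j \in M -> k \in M -> j != k ->
  \sum_(h | B h) G (tperm z j * tperm z k * h)%g = \sum_(h | A h && (h k == z)) G h.
  move=> jM kM jk; rewrite [RHS](reindex_inj (mulgI (tperm z j * tperm z k)%g)) /=.
  apply: eq_bigl => h; rewrite BE.
  have jz : z != j by apply: contraNneq zM => ->.
  have kz : z != k by apply: contraNneq zM => ->.
  congr (_ && _); last by rewrite !permM (tpermD kz jk) tpermR.
  rewrite /A !odd_permM !odd_tperm jz kz /=; congr (_ && _).
  apply/idP/idP => hM; first by rewrite !perm_onM ?tA.
  rewrite -[h](mulKg (tperm z j * tperm z k)%g); apply: perm_onM => //.
  by rewrite perm_onV // perm_onM ?tA.
have diag : \sum_(j in M) \sum_(h | B h) G (tperm z j * tperm z j * h)%g =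
   #|M|%:R * \sum_(h | A h && (h z == z)) G h.
  rewrite mulr_natl -sumr_const; apply: eq_bigr => j _; apply: eq_big => [h|h _]; first exact: BE.
  by rewrite tperm2 mul1g.
have off : \sum_(j in M) \sum_(k in M | k != j) \sum_(h | B h) G (tperm z j * tperm z k * h)%g =
   (#|M| - 1)%:R * \sum_(h | A h && (h z != z)) G h.
  rewrite (exchange_big_dep (mem M)) /=; last by move=> j k _ /andP[].
  transitivity (\sum_(k in M) (#|M| - 1)%:R * \sum_(h | A h && (h k == z)) G h).
    apply: eq_bigr => k kM.
    rewrite (eq_bigr (fun=> \sum_(h | A h && (h k == z)) G h)); last first.
      by move=> j /andP[jM kj]; apply: step; rewrite // eq_sym; case/andP: kj.
    rewrite (eq_bigl [in M :\ k]) ?sumr_const => [|j].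
      by rewrite mulr_natl [in RHS](cardsD1 k M) kM add1n subn1.
    by rewrite !inE kM /= andbC eq_sym.
  rewrite -mulr_sumr; congr (_ * _).
  rewrite [RHS](partition_big (fun h => h^-1 z)%g (mem M)) /=; last first.
    move=> h /andP[/andP[hM _] hz].
    have : (h^-1 z)%g \in z |: M by rewrite -(perm_closed _ hM) permKV setU11.
    by rewrite !inE => /orP[/eqP E|//]; case/negP: hz; rewrite -{1}E permKV.
  apply: eq_bigr => k kM; apply: eq_bigl => h; rewrite -andbA; congr (_ && _).
  have -> : ((h^-1)%g z == k) = (h k == z).
    by apply/eqP/eqP => [<-|<-]; rewrite ?permKV ?permK.
  case: eqP => [E|]; rewrite ?andbF // andbT; apply/esym; apply: contraNneq zM => hz.
  by rewrite -(perm_inj (etrans hz (esym E))) in kM *.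
have -> : \sum_(j in M) \sum_(k in M) \sum_(h | B h) G (tperm z j * tperm z k * h)%g =
  #|M|%:R * \sum_(h | A h && (h z == z)) G h + (#|M| - 1)%:R * \sum_(h | A h && (h z != z)) G h.
  rewrite -diag -off -big_split; apply: eq_bigr => j jM /=.
  by rewrite (bigD1 j).
rewrite (bigID (fun h : {perm I} => h z == z)) /= mulrDr lerD2r.
apply: ler_wpM2r; first by apply: sumr_ge0.
by rewrite ler_nat leq_subr.
Qed.

(* With [G] an indicator: an even permutation of [x0 :: z :: s] is a product of
   two cycles on [x0 :: z :: s] in at least [(size s)`!] ways. *)
Lemma sum_cycs2_ge z s (G : {perm I} -> R) : uniq (x0 :: z :: s) ->
  (forall x, 0 <= G x) ->
  (size s)`!%:R *
    \sum_(h : {perm I} | perm_on [set y in x0 :: z :: s] h && ~~ odd_perm h) G h <=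
  \sum_(c <- cycs (z :: s)) \sum_(c' <- cycs (z :: s)) G (c * c')%g.
Proof.
elim: s z G => [|z' s IH] z G us G0.
  (* On two points the only cycle is the transposition; its square is the identity, the only even
     permutation. *)
  rewrite mul1r !big_seq1 (eq_bigl (pred1 1%g)) => [|h].
    by rewrite big_pred1_eq /= mulg1 tperm2.
  apply/andP/eqP => [[hM eh]|->]; last by rewrite perm_on1 odd_perm1.
  have zx : x0 != z by move: us; rewrite /= inE andbT.
  have [hx|hx] := eqVneq (h x0) x0.
    have hz : h z = z.
      have : h z \in [set y in [:: x0; z]] by rewrite (perm_closed _ hM) !inE eqxx orbT.
      rewrite !inE => /orP[/eqP hz|/eqP //].
      by case/eqP: zx; apply: (@perm_inj _ h); rewrite hx hz.
    apply/permP => y; rewrite perm1; have [->//|yx] := eqVneq y x0.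
    have [->//|yz] := eqVneq y z.
    by apply: (out_perm hM); rewrite !inE negb_or yx.
  have hxz : h x0 = z.
    have : h x0 \in [set y in [:: x0; z]] by rewrite (perm_closed _ hM) !inE eqxx.
    by rewrite !inE (negPf hx) => /eqP.
  have hzx : h z = x0.
    have : h z \in [set y in [:: x0; z]] by rewrite (perm_closed _ hM) !inE eqxx orbT.
    rewrite !inE => /orP[/eqP //|/eqP hz].
    by case/eqP: zx; apply: (@perm_inj _ h); rewrite hxz hz.
  move: eh; suff -> : h = tperm x0 z by rewrite odd_tperm zx.
  apply/permP => y; case: tpermP => [->|->|/eqP yx /eqP yz] //.
  by apply: (out_perm hM); rewrite !inE negb_or yx.
have us' : uniq (x0 :: z' :: s).
  by move: us; rewrite /= inE negb_or => /andP[/andP[_ ->] /andP[]].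
set M := [set y in x0 :: z' :: s].
have zM : z \notin M.
  by move: us => /= /andP[]; rewrite !inE !negb_or eq_sym => /andP[->_]/andP[].
have cM : #|M| = (size s).+2 by rewrite /M cardsE (card_uniqP us').
have -> : [set y in x0 :: z :: z' :: s] = z |: M.
  by apply/setP => y; rewrite !inE orbCA.
have -> : \sum_(c <- cycs (z :: z' :: s)) \sum_(c' <- cycs (z :: z' :: s)) G (c * c')%g =
  \sum_(j in M) \sum_(k in M) \sum_(c <- cycs (z' :: s)) \sum_(c' <- cycs (z' :: s))
     G (tperm z j * tperm z k * (c * c'))%g.
  rewrite sum_cycs_cons.
  under eq_bigr => c _ do under eq_bigr => j _ do rewrite sum_cycs_cons exchange_big /=.
  (* Moving the second insertion in front of [c] replaces [k] by its preimage under [c], which only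
     permutes the index. *)
  have E c j : c \in cycs (z' :: s) ->
   \sum_(k <- x0 :: z' :: s) \sum_(c' <- cycs (z' :: s)) G (tperm z j * c * (tperm z k * c'))%g =
   \sum_(k in M) \sum_(c' <- cycs (z' :: s)) G (tperm z j * tperm z k * (c * c'))%g.
    move=> cs; rewrite big_uniq // (reindex_inj (@perm_inj _ c)) /=.
    apply: eq_big => [k|k _].
      by rewrite -[RHS](perm_closed k (cycs_on cs)) [in RHS]inE.
    apply: eq_bigr => c' _; congr G.
    have cz : c z = z by apply: (out_perm (cycs_on cs)).
    by rewrite -{2}cz -tpermJ conjgE !mulgA mulgK.
  transitivity (\sum_(c <- cycs (z' :: s)) \sum_(j <- x0 :: z' :: s)
     \sum_(k in M) \sum_(c' <- cycs (z' :: s)) G (tperm z j * tperm z k * (c * c'))%g).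
    by apply: eq_big_seq => c cs; apply: eq_bigr => j _; apply: E.
  rewrite exchange_big big_uniq //= /M; apply: eq_big => [j|j _]; first by rewrite [in RHS]inE.
  by rewrite exchange_big.
rewrite factS natrM -mulrA mulrCA.
apply: le_trans (_ : \sum_(j in M) \sum_(k in M) (size s)`!%:R *
   \sum_(h : {perm I} | perm_on M h && ~~ odd_perm h) G (tperm z j * tperm z k * h)%g <= _).
  under [X in _ <= X]eq_bigr do rewrite -mulr_sumr.
  rewrite -[X in _ <= X]mulr_sumr.
  apply: ler_wpM2l; first exact: ler0n.
  apply: le_trans (even_insert zM G0).
  by rewrite cM subn1 mulr_natl.
by apply: ler_sum => j _; apply: ler_sum => k _; apply: IH.
Qed.

(** The points of [s1] are split off to the left of the first cycle and those of [s2] to the right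
    of the second, which leaves two adjacent cycles on the common [x0 :: s]. The factors split off
    accumulate in [x] and [y]. *)
Lemma sum_cycs2_peel s1 s2 s (F : {perm I} -> R) B :
  uniq (x0 :: s1 ++ s) -> uniq (x0 :: s2 ++ s) ->
  (forall x y : {perm I}, B * (size (cycs s) * size (cycs s))%:R <=
    \sum_(c <- cycs s) \sum_(c' <- cycs s) F (x * (c * c') * y)%g) ->
  B * (size (cycs (s1 ++ s)) * size (cycs (s2 ++ s)))%:R <=
    \sum_(c <- cycs (s1 ++ s)) \sum_(c' <- cycs (s2 ++ s)) F (c * c')%g.
Proof.
elim: s1 F => [|z s1 IH1] F u1 u2 HB.
  rewrite cat0s; elim: s2 F u2 HB => [|z s2 IH2] F u2 HB.
    rewrite cat0s; have := HB 1%g 1%g; move/le_trans; apply.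
    by apply: ler_sum => c _; apply: ler_sum => c' _; rewrite mul1g mulg1.
  have u2' : uniq (x0 :: s2 ++ s).
    by move: u2; rewrite /= inE negb_or => /andP[/andP[_ ->] /andP[]].
  under eq_bigr do rewrite cat_cons sum_cycs_consR // exchange_big /=.
  rewrite exchange_big /=.
  apply: le_trans (_ : \sum_(j <- x0 :: s2 ++ s)
      B * (size (cycs s) * size (cycs (s2 ++ s)))%:R <= _).
    rewrite big_const_seq count_predT iter_addr addr0 [size (cycs (z :: _))]size_cycs /= factS -size_cycs.
    rewrite -[X in _ <= X]mulr_natr -mulrA -natrM le_eqVlt; apply/orP; left; apply/eqP.
    by congr (_ * _%:R); lia.
  apply: ler_sum => j _.
  have := IH2 (fun x => F (x * tperm z j)%g) u2'.
  move=> /(_ _)/le_trans; apply.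
    by move=> x y; have := HB x (y * tperm z j)%g; under eq_bigr do under eq_bigr do rewrite mulgA.
  by apply: ler_sum => c _; apply: ler_sum => c' _; rewrite mulgA.
have u1' : uniq (x0 :: s1 ++ s).
  by move: u1; rewrite /= inE negb_or => /andP[/andP[_ ->] /andP[]].
rewrite cat_cons sum_cycs_cons exchange_big /=.
apply: le_trans (_ : \sum_(j <- x0 :: s1 ++ s)
      B * (size (cycs (s1 ++ s)) * size (cycs (s2 ++ s)))%:R <= _).
  rewrite big_const_seq count_predT iter_addr addr0 [size (cycs (z :: _))]size_cycs /= factS -size_cycs.
  rewrite -[X in _ <= X]mulr_natr -mulrA -natrM le_eqVlt; apply/orP; left; apply/eqP.
  by congr (_ * _%:R); lia.
apply: ler_sum => j _.
have := IH1 (fun x => F (tperm z j * x)%g) u1' u2.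
move=> /(_ _)/le_trans; apply.
  by move=> x y; have := HB (tperm z j * x)%g y; under eq_bigr do under eq_bigr do rewrite -!mulgA;
     under [in X in _ -> X]eq_bigr do under eq_bigr do rewrite -!mulgA.
by apply: ler_sum => c _; apply: ler_sum => c' _; rewrite !mulgA.
Qed.

End Cycles.

(** * The uniform walk *)

Section Uniform.
Variables (R : realFieldType) (I : finType).
Hypothesis I0 : (0 < #|I|)%N.
Implicit Types (x g h y : {perm I}) (u v : {perm I} -> R) (M Y : {set I}).

Let N := #|I|%:R : R.
Let N0 : 0 < N. Proof. by rewrite ltr0n. Qed.

Definition unif (i : I) : R := #|I|%:R^-1.

Lemma distr_unif : distr unif.
Proof.
split=> [i|]; first by rewrite invr_ge0 ler0n.
by rewrite sumr_const cardT -cardE -[LHS]mulr_natl divff // lt0r_neq0.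
Qed.

Lemma walk_unif_conj u : (forall x y, u (x ^ y)%g = u x) ->
  forall x y, walk unif u (x ^ y)%g = walk unif u x.
Proof.
move=> Hu x y; rewrite /walk (reindex_inj (@perm_inj _ y)) /=.
apply: eq_bigr => r _; rewrite (reindex_inj (@perm_inj _ y)) /=.
by apply: eq_bigr => l _; rewrite -tpermJ -conjMg Hu.
Qed.

Let f j := iter j (walk unif) (@dirac R I).

Lemma unif_conj j x y : f j (x ^ y)%g = f j x.
Proof.
elim: j x y => [|j IH] x y; last exact: walk_unif_conj.
by rewrite /f /= /dirac -(inj_eq (@conjg_inj _ y) x 1%g) conj1g.
Qed.

Lemma iter_dirac_ge0 p j x : @distr R I p -> 0 <= iter j (walk p) (@dirac R I) x.
Proof. by move=> dp; apply: iter_walk_ge => // z; apply: ler0n. Qed.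

Lemma iter_dirac_sum p j : @distr R I p -> \sum_x iter j (walk p) (@dirac R I) x = 1.
Proof.
move=> dp; have E i g : iter i (walk p) (fun=> 1) g = 1 :> R.
  by elim: i g => //= i IH g; rewrite (eq_walk p IH) walk_cst.
rewrite -(E j 1%g) iter_walk_dirac.
by under [RHS]eq_bigr do rewrite mulr1.
Qed.

Lemma f_ge0 j x : 0 <= f j x. Proof. exact: iter_dirac_ge0 distr_unif. Qed.
Lemma f_sum j : \sum_x f j x = 1. Proof. exact: iter_dirac_sum distr_unif. Qed.

(** The probability that two independent uniform points lie on the same cycle of [x]. *)
Definition samecyc x : R := \sum_r \sum_l (r \in porbit x l)%:R / N ^+ 2.

(** A transposition merges two cycles or splits one. The only loss is at [r = l], where the count is
    unchanged but is allowed to grow by one. *)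
Lemma walk_porbits x : walk unif (fun y => #|porbits y|%:R) x <=
  #|porbits x|%:R - 1 + 2 * samecyc x.
Proof.
have -> : #|porbits x|%:R - 1 + 2 * samecyc x =
  \sum_r \sum_l unif r * unif l * (#|porbits x|%:R - 1 + 2 * (r \in porbit x l)%:R).
  transitivity (walk unif (fun=> #|porbits x|%:R - 1) x + 2 * samecyc x).
    by rewrite walk_cst //; exact: distr_unif.
  rewrite /samecyc mulr_sumr -big_split; apply: eq_bigr => r _.
  rewrite mulr_sumr -big_split; apply: eq_bigr => l _ /=.
  by rewrite /unif -/N; field; apply: lt0r_neq0.
apply: ler_sum => r _; apply: ler_sum => l _; apply: ler_wpM2l.
  by rewrite mulr_ge0 // invr_ge0 ler0n.
have /(congr1 (fun n : nat => n%:R : R)) := porbits_mul_tperm x r l.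
rewrite !natrD -mul2n natrM.
case: (r \in porbit x l) => /=; case: eqP => _ /=; rewrite ?mulr0 ?mulr1 => E; lra.
Qed.

(* A uniform step changes the number of cycles by [-1] if its two cards lie in
   different cycles and by at most [1] otherwise; as that number starts at
   [#|I|] and stays nonnegative, two random points must often share a cycle. *)
Lemma exists_samecyc : exists2 j, (j < 4 * #|I|)%N &
  3%:R / 8%:R <= \sum_x f j x * samecyc x.
Proof.
case: (boolP [exists j : 'I_(4 * #|I|), 3%:R / 8%:R <= \sum_x f j x * samecyc x]).
  by case/existsP => j Hj; exists j.
rewrite negb_exists => /forallP H; exfalso.
pose cc j := \sum_x f j x * #|porbits x|%:R.
have c0 : cc 0%N <= N.
  rewrite /cc (bigD1 1%g) //= big1 => [|x /negPf xn]; last by rewrite /f /= /dirac xn mul0r.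
  rewrite /f /= /dirac eqxx mul1r addr0 ler_nat /porbits.
  by apply: leq_trans (leq_imset_card _ _) _; rewrite max_card.
(* The drift is below [-1 + 2 * 3/8 = -1/4], so [4 * #|I|] such steps would push the count from at
   most [#|I|] below zero. *)
have cS j : (j < 4 * #|I|)%N -> cc j.+1 < cc j - 4%:R^-1.
  move=> jN; have {}H := H (Ordinal jN); rewrite -ltNge /= in H.
  rewrite /cc /f iterS walk_selfadj -/(f j).
  apply: le_lt_trans (_ : \sum_x f j x * (#|porbits x|%:R - 1 + 2 * samecyc x) < _).
    by apply: ler_sum => x _; apply: ler_wpM2l; [apply: f_ge0 | apply: walk_porbits].
  have -> : \sum_x f j x * (#|porbits x|%:R - 1 + 2 * samecyc x) =
     cc j - 1 + 2 * \sum_x f j x * samecyc x.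
    have -> : cc j - 1 = \sum_x (f j x * #|porbits x|%:R - f j x) by rewrite sumrB f_sum.
    by rewrite mulr_sumr -big_split; apply: eq_bigr => x _ /=; ring.
  by rewrite -/(cc j); lra.
have cle j : (j <= 4 * #|I|)%N -> cc j <= N - j%:R / 4%:R.
  elim: j => [|j IH] jN; first by rewrite mul0r subr0.
  have := cS j jN; have := IH (ltnW jN); rewrite -natr1; lra.
have N1 : ((4 * #|I|).-1 < 4 * #|I|)%N by lia.
have := cS _ N1; have := cle _ (ltnW N1); rewrite prednK; last by lia.
have : (0 : R) <= cc (4 * #|I|)%N.
  by apply: sumr_ge0 => x _; apply: mulr_ge0; [apply: f_ge0 | apply: ler0n].
have -> : ((4 * #|I|).-1%:R : R) = 4 * N - 1.
  by rewrite -subn1 natrB ?natrM //; lia.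
lra.
Qed.

(** * Long cycles and the product of two independent samples *)

Lemma sum_card_porbit x : samecyc x * N ^+ 2 = \sum_l #|porbit x l|%:R.
Proof.
rewrite /samecyc exchange_big mulr_suml; apply: eq_bigr => l _ /=.
rewrite mulr_suml -sum1_card natr_sum [in RHS]big_mkcond; apply: eq_bigr => r _ /=.
by rewrite mulfVK ?expf_neq0 ?lt0r_neq0 //; case: (_ \in _).
Qed.

(** The mean cycle length of a uniform point is [#|I| * samecyc x], and some point [x0] reaches at
    least the average. *)
Lemma exists_long_porbit : exists j (x0 : I), (j < 4 * #|I|)%N /\
  3%:R / 8%:R * N <= \sum_x f j x * #|porbit x x0|%:R.
Proof.
have [j jN Hj] := exists_samecyc.
case: (boolP [exists x0 : I, 3%:R / 8%:R * N <= \sum_x f j x * #|porbit x x0|%:R]).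
  by case/existsP => x0 H; exists j, x0.
rewrite negb_exists => /forallP H; exfalso.
have : \sum_(x0 : I) \sum_x f j x * #|porbit x x0|%:R < \sum_(x0 : I) 3%:R / 8%:R * N.
  have /card_gt0P[i0 _] := I0.
  rewrite [X in X < _](bigD1 i0) //= [X in _ < X](bigD1 i0) //=.
  by apply: ltr_leD; [rewrite ltNge H | apply: ler_sum => i _; apply: ltW; rewrite ltNge H].
rewrite exchange_big /=; under eq_bigr do rewrite -mulr_sumr -sum_card_porbit mulrA.
rewrite -mulr_suml sumr_const cardT -cardE -[X in _ < X]mulr_natl -/N.
have := Hj; rewrite -(@ler_pM2r _ (N ^+ 2)) ?exprn_gt0 //; lra.
Qed.

Lemma perm_on_fixes (s : seq I) x : fixes s x -> perm_on (~: [set y in s]) x.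
Proof.
move=> /allP xs; apply/subsetP => y; rewrite !inE; apply: contra => ys.
exact: xs.
Qed.

(** As [f j] is a class function, the cycle of [x0], given its support, is uniform. The product of
    two samples thus contains a product of two uniform cycles on [Y' :&: Y], which dominates a
    multiple of the uniform measure on the even permutations there. *)
Lemma cycle_pair_ge j (x0 : I) Y Y' k c v g : (1 < k)%N -> 0 <= c ->
  (forall x, 0 <= v x) -> mixing true k c v -> (k <= #|Y' :&: Y|)%N ->
  c * ((\sum_(x' : {perm I} | porbit x' x0 == Y') f j x') *
       (\sum_(x : {perm I} | porbit x x0 == Y) f j x)) <=
  \sum_(x' : {perm I} | porbit x' x0 == Y') \sum_(x : {perm I} | porbit x x0 == Y)
     f j x' * f j x * v (x' * x * g)%g.
Proof.
move=> k1 c0 v0 Hv kY.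
have [xY'|xY'] := boolP (x0 \in Y'); last first.
  have P0 (x : {perm I}) : (porbit x x0 == Y') = false.
    by apply/negP => /eqP E; move: xY'; rewrite -E porbit_id.
  by rewrite [X in X <= _](_ : _ = 0) ?sumr_ge0 // => [x|]; rewrite ?P0 // big_pred0 ?mul0r ?mulr0.
have [xY|xY] := boolP (x0 \in Y); last first.
  rewrite [X in _ * (_ * X)]big_pred0 => [|x]; last first.
    by apply/negP => /eqP E; move: xY; rewrite -E porbit_id.
  rewrite !mulr0; apply: sumr_ge0 => x _; apply: sumr_ge0 => x' _.
  by rewrite !mulr_ge0 ?f_ge0.
move Mdef : (Y' :&: Y) kY => M kY.
(* The common points other than [x0], and the points on only one of the two cycles. *)
pose s := enum (M :\ x0); pose s1 := enum (Y' :\: M); pose s2 := enum (Y :\: M).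
have xM : x0 \in M by rewrite -Mdef inE xY' xY.
have enumY (Z : {set I}) : M \subset Z ->
   uniq (x0 :: enum (Z :\: M) ++ s) /\ [set y in x0 :: enum (Z :\: M) ++ s] = Z.
  move=> MZ; split.
    rewrite /= mem_cat !mem_enum !inE xM eqxx /= cat_uniq !enum_uniq /= andbT.
    by apply/hasPn => y; rewrite !mem_enum !inE => /andP[_ ->].
  apply/setP => y; rewrite !inE mem_cat !mem_enum !inE.
  have [->|yx] := eqVneq y x0; first by rewrite (subsetP MZ).
  by case yM: (y \in M); rewrite /= ?orbF // (subsetP MZ).
have MY' : M \subset Y' by rewrite -Mdef subsetIl.
have MY : M \subset Y by rewrite -Mdef subsetIr.
have [u1 e1] := enumY Y' MY'; have [u2 e2] := enumY Y MY.
rewrite -/s1 in u1 e1; rewrite -/s2 in u2 e2.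
have us : uniq (x0 :: s) by rewrite /= mem_enum !inE eqxx enum_uniq.
have es : [set y in x0 :: s] = M.
  apply/setP => y; rewrite !inE mem_enum !inE.
  by have [->|] := eqVneq y x0; rewrite ?xM.
have sumP s' (H : {perm I} -> R) Z : uniq (x0 :: s') -> [set y in x0 :: s'] = Z ->
  \sum_(x : {perm I} | porbit x x0 == Z) H x =
  \sum_(c <- cycs x0 s') \sum_(r : {perm I} | fixes (x0 :: s') r) H (c * r)%g.
  move=> us' <-; have := @sum_porbit R I x0 s' [::] H; rewrite cats0 => /(_ us') <-.
  by apply: eq_bigl => x; rewrite andbT.
(* The list is nonempty, so [head] selects a representative cycle and its default is never
   reached. *)
have cyc0 s' : head 1%g (cycs x0 s') \in cycs x0 s'.
  by have := fact_gt0 (size s'); rewrite -(size_cycs x0); case: cycs => //= a l _; rewrite mem_head.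
have fC s' c1 r : uniq (x0 :: s') -> fixes (x0 :: s') r -> c1 \in cycs x0 s' ->
   f j (c1 * r)%g = f j (head 1%g (cycs x0 s') * r)%g.
  move=> us' fr cs; have [y [_ _ <-]] := cycs_conj us' fr cs (cyc0 s').
  by rewrite unif_conj.
have comm s' c1 r : fixes (x0 :: s') r -> c1 \in cycs x0 s' -> (c1 * r = r * c1)%g.
  move=> fr cs; apply: (perm_onC (cycs_on cs) (perm_on_fixes fr)).
  by rewrite -setI_eq0 setICr.
have massE s' : uniq (x0 :: s') ->
  \sum_(c <- cycs x0 s') \sum_(r : {perm I} | fixes (x0 :: s') r) f j (c * r)%g =
  (size (cycs x0 s'))%:R * \sum_(r : {perm I} | fixes (x0 :: s') r) f j (head 1%g (cycs x0 s') * r)%g.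
  move=> us'; rewrite (eq_big_seq (fun=> \sum_(r : {perm I} | fixes (x0 :: s') r) f j (head 1%g (cycs x0 s') * r)%g)).
    by rewrite big_const_seq count_predT iter_addr addr0 mulr_natl.
  by move=> c1 cs; apply: eq_bigr => r fr; apply: fC.
have -> : \sum_(x' : {perm I} | porbit x' x0 == Y') \sum_(x : {perm I} | porbit x x0 == Y)
     f j x' * f j x * v (x' * x * g)%g =
   \sum_(r' : {perm I} | fixes (x0 :: s1 ++ s) r') \sum_(r : {perm I} | fixes (x0 :: s2 ++ s) r)
    f j (head 1%g (cycs x0 (s1 ++ s)) * r')%g * f j (head 1%g (cycs x0 (s2 ++ s)) * r)%g *
    \sum_(c1 <- cycs x0 (s1 ++ s)) \sum_(c2 <- cycs x0 (s2 ++ s)) v (r' * (c1 * c2) * (r * g))%g.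
  rewrite (sumP (s1 ++ s)) // exchange_big /=; apply: eq_bigr => r' fr'.
  transitivity (\sum_(c1 <- cycs x0 (s1 ++ s)) \sum_(r : {perm I} | fixes (x0 :: s2 ++ s) r) \sum_(c2 <- cycs x0 (s2 ++ s))
    f j (head 1%g (cycs x0 (s1 ++ s)) * r')%g * f j (head 1%g (cycs x0 (s2 ++ s)) * r)%g * v (r' * (c1 * c2) * (r * g))%g).
    apply: eq_big_seq => c1 c1s; rewrite (sumP (s2 ++ s)) // exchange_big /=.
    apply: eq_bigr => r fr; apply: eq_big_seq => c2 c2s.
    by rewrite (fC (s1 ++ s) c1) // (fC (s2 ++ s) c2) // (comm (s1 ++ s) c1 r') // !mulgA.
  rewrite exchange_big /=; apply: eq_bigr => r fr; rewrite mulr_sumr; apply: eq_bigr => c1 _.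
  by rewrite mulr_sumr.
rewrite (sumP (s1 ++ s)) // (sumP (s2 ++ s)) // !massE //.
apply: le_trans (_ : \sum_(r' : {perm I} | fixes (x0 :: s1 ++ s) r') \sum_(r : {perm I} | fixes (x0 :: s2 ++ s) r)
    f j (head 1%g (cycs x0 (s1 ++ s)) * r')%g * f j (head 1%g (cycs x0 (s2 ++ s)) * r)%g *
    (c * (size (cycs x0 (s1 ++ s)) * size (cycs x0 (s2 ++ s)))%:R) <= _).
  rewrite natrM -mulrACA.
  under [X in _ <= X]eq_bigr do rewrite -mulr_suml -mulr_sumr.
  by rewrite -!mulr_suml le_eqVlt; apply/orP; left; apply/eqP; ring.
apply: ler_sum => r' _; apply: ler_sum => r _; apply: ler_wpM2l.
  by rewrite mulr_ge0 ?f_ge0.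
apply: (@sum_cycs2_peel R I x0 s1 s2 s (fun y => v (r' * y * (r * g))%g) c u1 u2) => x y.
have cM : #|M| = (size s).+1 by rewrite -es cardsE (card_uniqP us).
have s0 : (0 < size s)%N by rewrite -ltnS -cM; apply: leq_trans kY.
have [z [s' sE]] : exists z s', s = z :: s' by case: (s) s0 => [|z s'] // _; exists z, s'.
rewrite sE in us es cM *.
(* With [m = size s'] and [#|M| = m + 2] this rests on [(m + 1)!^2 <= m! (m + 2)!]. *)
apply: le_trans (_ : (size s')`!%:R * (c * #|M|`!%:R) <= _).
  rewrite !size_cycs cM /= mulrCA -natrM; apply: ler_wpM2l => //.
  rewrite ler_nat !factS; nia.
apply: le_trans (_ : (size s')`!%:R * \sum_(h : {perm I} | perm_on [set y in x0 :: z :: s'] h && ~~ odd_perm h)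
    v (r' * (x * h * y) * (r * g))%g <= _); last first.
  by apply: (sum_cycs2_ge (G := fun h => v (r' * (x * h * y) * (r * g))%g)).
apply: ler_wpM2l; first exact: ler0n.
rewrite es; have := Hv ((r' * x)%g @^-1: M) (r' * x * (y * r * g))%g.
rewrite card_preim_perm => /(_ kY); rewrite -symsum_transl.
by under eq_bigr do rewrite !mulgA; under [X in _ -> _ <= X]eq_bigr do rewrite !mulgA.
Qed.

Lemma card_setI_sum (A B : {set I}) : #|A :&: B|%:R = \sum_i ((i \in A)%:R * (i \in B)%:R) :> R.
Proof.
rewrite -sum1_card natr_sum big_mkcond /=; apply: eq_bigr => i _.
by rewrite inE; do 2!case: (_ \in _); rewrite ?mulr1 ?mulr0.
Qed.

(** Two independent samples at a time [j] with a long cycle take [J = j + j] steps. If [th i] is the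
    probability that [i] lies on the cycle of [x0], the mean overlap of the two cycles is the sum of
    the [th i ^+ 2], at least [9/64 * #|I|] by convexity. Overlaps below [k <= #|I| / 32] account
    for at most [2/64] of this, so an overlap of at least [k] has probability at least [7/64]. *)
Lemma unif_walk_ge : exists2 J, (J <= 8 * #|I|)%N &
  forall k c v g, (1 < k)%N -> (32 * k <= #|I|)%N -> 0 <= c ->
  (forall x, 0 <= v x) -> mixing true k c v ->
  7%:R / 64%:R * c <= iter J (walk unif) v g.
Proof.
have [j [x0 [jN Hj]]] := exists_long_porbit.
exists (j + j)%N; first by lia.
move=> k c v g k1 kN c0 v0 Hv; rewrite iterD iter_walk_dirac -/(f j).
under eq_bigr do rewrite iter_walk_dirac -/(f j) mulr_sumr.
have -> : \sum_x \sum_x' f j x * (f j x' * v (x' * (x * g))%g) =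
   \sum_Y' \sum_Y \sum_(x' : {perm I} | porbit x' x0 == Y') \sum_(x : {perm I} | porbit x x0 == Y)
     f j x' * f j x * v (x' * x * g)%g.
  rewrite exchange_big /= (partition_big (fun x => porbit x x0) predT) //=.
  apply: eq_bigr => Y' _; rewrite [RHS]exchange_big /=; apply: eq_bigr => x' _.
  rewrite (partition_big (fun x => porbit x x0) predT) //=.
  apply: eq_bigr => Y _; apply: eq_bigr => x _.
  by rewrite mulgA mulrA [f j x * _]mulrC.
pose q Y : R := \sum_(x : {perm I} | porbit x x0 == Y) f j x.
apply: le_trans (_ : \sum_Y' \sum_Y c * (q Y' * q Y * (k <= #|Y' :&: Y|)%N%:R) <= _); last first.
  apply: ler_sum => Y' _; apply: ler_sum => Y _.
  case: leqP => kY; rewrite ?mulr1 ?mulr0; first exact: cycle_pair_ge Hv kY.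
  by apply: sumr_ge0 => x' _; apply: sumr_ge0 => x _; rewrite !mulr_ge0 ?f_ge0.
under eq_bigr do rewrite -mulr_sumr; rewrite -mulr_sumr mulrC; apply: ler_wpM2l => //.
have q0 Y : 0 <= q Y by apply: sumr_ge0 => x _; apply: f_ge0.
have q1 : \sum_Y q Y = 1.
  by rewrite -(f_sum j) (partition_big (fun x => porbit x x0) predT).
pose th i : R := \sum_Y q Y * (i \in Y)%:R.
have thE : \sum_i th i = \sum_x f j x * #|porbit x x0|%:R.
  rewrite exchange_big /= [RHS](partition_big (fun x => porbit x x0) predT) //=.
  apply: eq_bigr => Y _; rewrite -mulr_sumr /q mulr_suml.
  have -> : \sum_i ((i \in Y)%:R : R) = #|Y|%:R.
    by rewrite -sum1_card natr_sum [in RHS]big_mkcond; apply: eq_bigr => i _; case: (_ \in _).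
  by apply: eq_bigr => x /eqP ->.
have sq : \sum_i th i ^+ 2 >= 9%:R / 64%:R * N.
  have : 0 <= \sum_i (th i - 3%:R / 8%:R) ^+ 2 by apply: sumr_ge0 => i _; apply: sqr_ge0.
  have -> : \sum_i (th i - 3%:R / 8%:R) ^+ 2 =
    \sum_i th i ^+ 2 - 3%:R / 4%:R * \sum_i th i + 9%:R / 64%:R * N.
    have -> : 9%:R / 64%:R * N = \sum_(i : I) (9%:R / 64%:R).
      by rewrite sumr_const cardT -cardE mulr_natr.
    rewrite mulr_sumr -sumrB -big_split; apply: eq_bigr => i _ /=.
    by field.
  rewrite thE; move: (\sum_i _) Hj => S Hj; lra.
have sq2 : \sum_i th i ^+ 2 = \sum_Y' \sum_Y q Y' * q Y * #|Y' :&: Y|%:R.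
  under [RHS]eq_bigr do under eq_bigr do rewrite card_setI_sum mulr_sumr.
  under [RHS]eq_bigr do rewrite exchange_big /=.
  rewrite [RHS]exchange_big /=; apply: eq_bigr => i _.
  rewrite expr2 /th mulr_suml; apply: eq_bigr => Y' _.
  rewrite mulr_sumr; apply: eq_bigr => Y _; ring.
have up : \sum_Y' \sum_Y q Y' * q Y * #|Y' :&: Y|%:R <=
   N * (\sum_Y' \sum_Y q Y' * q Y * (k <= #|Y' :&: Y|)%N%:R) + k%:R.
  have -> : (k%:R : R) = \sum_Y' \sum_Y q Y' * q Y * k%:R.
    by under [RHS]eq_bigr do rewrite -mulr_suml -mulr_sumr; rewrite q1 -mulr_suml -mulr_suml q1 !mul1r.
  rewrite mulr_sumr -big_split; apply: ler_sum => Y' _ /=.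
  rewrite mulr_sumr -big_split; apply: ler_sum => Y _ /=.
  rewrite mulrCA -mulrDr; apply: ler_wpM2l; first exact: mulr_ge0.
  case: leqP => kY /=; last by rewrite mulr0 add0r ler_nat ltnW.
  rewrite mulr1 -[X in X <= _]addr0; apply: lerD => //.
  by rewrite ler_nat max_card.
have kN' : 32%:R * k%:R <= N by rewrite -natrM ler_nat.
rewrite -(ler_pM2l N0).
rewrite sq2 in sq; move: sq up; move: (\sum_Y' _) (\sum_Y' _) => S1 S2; lra.
Qed.

End Uniform.

(** * Reaching a constant fraction of marked cards *)

Section Early.
Variables (R : realFieldType) (I : finType).
Implicit Types (x g h y : {perm I}) (u v : {perm I} -> R) (M : {set I}).

Lemma symsum_even_odd r l M u g : r \in M -> l \in M -> r != l ->
  symsum true M u g + symsum true M u (tperm r l * g)%g = symsum false M u g.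
Proof.
move=> rM lM rl; rewrite /symsum [RHS](bigID (fun h : {perm I} => ~~ odd_perm h)) /=.
congr (_ + _); first by apply: eq_bigl => h; rewrite andbT.
rewrite [RHS](reindex_inj (mulIg (tperm r l))) /=; apply: eq_big => [h|h _]; last by rewrite mulgA.
have tM : perm_on M (tperm r l).
  by apply: subset_trans (tperm_on _ _) _; apply/subsetP => y; rewrite !inE => /orP[]/eqP->.
rewrite andbT odd_permM odd_tperm rl addbT negbK; congr (_ && _).
apply/idP/idP => hM; first exact: perm_onM.
by rewrite -[h](mulgK (tperm r l)) perm_onM // perm_onV.
Qed.

Variables (p : I -> R) (e : R).
Hypotheses (dp : distr p) (e0 : 0 <= e) (pe : forall i, e <= p i).

(* A step [(r, r)] keeps the parity, a step [(r, r0)] reverses it, and both have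
   probability at least [e ^+ 2]: together they turn an average over even
   permutations into one over all permutations. *)
Lemma mixing_even k c v (q := 2 * (k - 1)%:R * e ^+ 2) j : (1 < k)%N -> 0 <= c -> q <= 1 ->
  (forall x, 0 <= v x) -> mixing false k c v ->
  mixing true k ((1 - (1 - q) ^+ j) * (c / 2)) (iter j (walk p) v).
Proof.
move=> k1 c0 q1 v0 Hv; elim: j => [|j IH] M g kM.
  by rewrite expr0 subrr !mul0r; apply: sumr_ge0.
rewrite /= symsum_walk; set u := iter j (walk p) v in IH *.
have Hu : mixing false k c u by apply: mixing_iter_walk.
set y := (1 - q) ^+ j in IH; pose F : R := #|M|`!%:R; pose L := (1 - y) * (c / 2) * F.
have F0 : 0 < F by apply: fact_gt0R.
pose phi r l := symsum true (tperm r l @^-1: M) u (tperm r l * g)%g.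
have phiL r l : L <= phi r l.
  by have := IH (tperm r l @^-1: M) (tperm r l * g)%g; rewrite card_preim_perm; apply.
have M0 : (0 < #|M|)%N by apply: leq_trans kM; lia.
(* One fixed [r0] is enough: with [e] of order [1 / #|I|] and [k] of order [#|I|], the [#|M| - 1]
   choices of [r] yield a gain of order [1 / #|I|] per step. *)
have /card_gt0P[r0 r0M] := M0.
have pair r : r \in M :\ r0 -> c * F <= phi r r + phi r r0.
  rewrite !inE => /andP[rr0 rM].
  rewrite /phi tperm1 mul1g !preim_tperm_in ?rM ?r0M // (_ : _ @^-1: M = M); last first.
    by apply/setP => z; rewrite inE perm1.
  by rewrite symsum_even_odd //; apply: Hu.
have [p0 p1] := dp.
have tot : \sum_r \sum_l p r * p l * (phi r l - L) >=
    \sum_(r in M :\ r0) e ^+ 2 * (c * F - 2 * L).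
  rewrite [X in _ <= X](bigID (mem (M :\ r0))) /= -[X in X <= _]addr0.
  have nn r l : 0 <= p r * p l * (phi r l - L).
    by rewrite !mulr_ge0 // subr_ge0.
  apply: lerD; last by apply: sumr_ge0 => r _; apply: sumr_ge0 => l _.
  apply: ler_sum => r rM.
  have rr0 : r0 != r by move: rM; rewrite !inE eq_sym => /andP[].
  rewrite (bigD1 r) //= (bigD1 r0) //= addrA -[X in X <= _]addr0.
  apply: lerD; last by apply: sumr_ge0.
  have ee i k' : e ^+ 2 <= p i * p k' by rewrite expr2; apply: ler_pM.
  apply: (@le_trans _ _ (e ^+ 2 * (phi r r - L) + e ^+ 2 * (phi r r0 - L))).
    rewrite -mulrDr; apply: ler_wpM2l; first exact: sqr_ge0.
    by have := pair r rM; lra.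
  by apply: lerD; apply: ler_wpM2r => //; rewrite subr_ge0.
have E : \sum_r \sum_l p r * p l * (phi r l - L) = \sum_r \sum_l p r * p l * phi r l - L.
  have -> : L = \sum_r \sum_l p r * p l * L.
    by under [RHS]eq_bigr do rewrite -mulr_suml; rewrite -mulr_suml distr_pair // mul1r.
  rewrite -sumrB; apply: eq_bigr => r _; rewrite -sumrB; apply: eq_bigr => l _.
  have -> : \sum_r0 \sum_l0 p r0 * p l0 * L = L; last by rewrite mulrBr.
  by under eq_bigr do rewrite -mulr_suml; rewrite -mulr_suml distr_pair // mul1r.
rewrite E sumr_const in tot.
have cM : #|M :\ r0| = (#|M| - 1)%N by rewrite (cardsD1 r0 M) r0M add1n subn1.
rewrite cM -[X in X <= _]mulr_natr in tot.
have LE : c * F - 2 * L = y * c * F by rewrite /L; field.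
rewrite LE in tot.
have y0 : 0 <= y by apply: exprn_ge0; rewrite subr_ge0.
have qM : q * (y * c * F) <= 2 * (#|M| - 1)%:R * e ^+ 2 * (y * c * F).
  apply: ler_wpM2r; first by rewrite !mulr_ge0 // ltW.
  apply: ler_wpM2r; first exact: sqr_ge0.
  by apply: ler_wpM2l => //; rewrite ler_nat leq_sub2r.
rewrite exprS -/y -/F; rewrite /L in tot; move: (\sum_r _) tot qM => S tot qM; lra.
Qed.

(** * Extraction of uniform steps from the walk *)

Lemma walk_unif_transl u x g :
  walk (@unif R I) u (x * g)%g = walk (@unif R I) (fun y => u (x * y)%g) g.
Proof.
rewrite /walk [RHS](reindex_inj (@perm_inj _ x)); apply: eq_bigr => r _ /=.
rewrite [RHS](reindex_inj (@perm_inj _ x)); apply: eq_bigr => l _ /=.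
by rewrite -tpermJ conjgE !mulgA mulgV mul1g.
Qed.

Lemma walk_unifC u : walk (@unif R I) (walk p u) =1 walk p (walk (@unif R I) u).
Proof.
move=> g; pose U := @unif R I.
transitivity (\sum_(rl : I * I) \sum_(rl' : I * I)
  p rl'.1 * p rl'.2 * (U rl.1 * U rl.2 * u (tperm rl'.1 rl'.2 * (tperm rl.1 rl.2 * g))%g)).
  rewrite [LHS]/walk pair_bigA; apply: eq_bigr => -[r l] _ /=.
  rewrite /walk pair_bigA mulr_sumr; apply: eq_bigr => -[r' l'] _ /=.
  by rewrite -/(U r) -/(U l); ring.
rewrite exchange_big [RHS]/walk [RHS]pair_bigA; apply: eq_bigr => -[r' l'] _ /=.
rewrite walk_unif_transl /walk [in RHS]pair_bigA mulr_sumr; apply: eq_bigr => -[r l] _ //.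
Qed.

Lemma iter_walk_unifC i u :
  iter i (walk (@unif R I)) (walk p u) =1 walk p (iter i (walk (@unif R I)) u).
Proof.
elim: i => // i IH g /=; rewrite (eq_walk _ IH); exact: walk_unifC.
Qed.

Hypothesis (I0 : (0 < #|I|)%N).
Variable a : R.
Hypotheses (a0 : 0 < a) (a1 : a <= 1) (eE : e = a / #|I|%:R).

Let N0 : 0 < #|I|%:R :> R. Proof. by rewrite ltr0n. Qed.

Lemma walk_ge_unif u m g : (forall x, m <= u x) ->
  a ^+ 2 * walk (@unif R I) u g + (1 - a ^+ 2) * m <= walk p u g.
Proof.
move=> um; have [p0 p1] := dp; have dU := distr_unif R I0.
suff : a ^+ 2 * (walk (@unif R I) u g - m) <= walk p u g - m by lra.
rewrite -!walkB // mulr_sumr; apply: ler_sum => r _; rewrite mulr_sumr; apply: ler_sum => l _.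
rewrite mulrA; apply: ler_wpM2r; first by rewrite subr_ge0.
have -> : a ^+ 2 * (@unif R I r * @unif R I l) = e * e.
  by rewrite /unif eE; field; apply: lt0r_neq0.
exact: ler_pM.
Qed.

(* The walk dominates [a ^+ 2] times the uniform walk, which commutes with it,
   so that [J] uniform steps can be extracted from a multiple of [J] steps. *)
Lemma iter_walk_ge_unif J c v : 0 <= c -> (forall x, 0 <= v x) ->
  (forall s g, c <= iter J (walk (@unif R I)) (iter s (walk p) v) g) ->
  forall s d g, (d <= J)%N ->
  (1 - 2 ^+ d * (1 - a ^+ 2 / 2) ^+ s) * c <=
    iter (J - d) (walk (@unif R I)) (iter s (walk p) v) g.
Proof.
move=> c0 v0 Hc; have dU := distr_unif R I0.
have a2 : a ^+ 2 <= 1 by rewrite exprn_ile1 // ltW.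
have rho0 : 0 <= 1 - a ^+ 2 / 2 by lra.
elim=> [|s IH] d g dJ.
  apply: le_trans (_ : 0 <= _).
    rewrite expr0 mulr1 mulr_le0_ge0 // subr_le0.
    by rewrite exprn_ege1 // ler1n.
  by apply: iter_walk_ge => // x; apply: iter_walk_ge.
case: d dJ => [|d] dJ.
  rewrite subn0; apply: le_trans (Hc s.+1 g); rewrite -[X in _ <= X]mul1r.
  by apply: ler_wpM2r => //; rewrite gerBl expr0 mul1r exprn_ge0.
(* With weight [a^2] the step is uniform and lowers [d] by one; otherwise the bound for [d + 1] is
   kept. The factor [2^d] fits since [a^2 2^d + (1 - a^2) 2^(d+1) = 2^(d+1) (1 - a^2 / 2)]. *)
rewrite [iter s.+1 _ _]iterS iter_walk_unifC.
apply: le_trans (walk_ge_unif _ (IH d.+1 ^~ dJ)).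
have := IH d g (ltnW dJ); rewrite -[(J - d)%N](@prednK (J - d)) ?subn_gt0 // iterS.
rewrite -subnS; set w := walk _ _ _; rewrite -(ler_pM2l (exprn_gt0 2 a0)) => H.
apply: le_trans (lerD H (lexx _)).
by rewrite !exprS; set y := _ ^+ s; set z := 2 ^+ d; rewrite le_eqVlt; apply/orP; left; apply/eqP; field.
Qed.

(** Of the [9 n] halvings, [8 n] cancel [2 ^+ J] and the last [n] leave at most one half. *)
Lemma pow_budget J n W (r : R) : (J <= 8 * n)%N -> (0 < n)%N -> 0 <= r ->
  r ^+ W <= (2 ^+ 9)^-1 -> 2 ^+ J * r ^+ (W * n) <= 2^-1.
Proof.
move=> Jn n0 r0 Hr.
have g1 : 1 < 2 :> R by rewrite ltr1n.
have h1 : (2 : R) ^+ J <= 2 ^+ (8 * n) by rewrite ler_eXn2l.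
have h2 : r ^+ (W * n) <= ((2 ^+ 9)^-1) ^+ n.
  by rewrite exprM; apply: lerXn2r; rewrite ?nnegrE ?invr_ge0 ?exprn_ge0.
have h00 : 0 <= (2 : R) ^+ J by apply: exprn_ge0; apply: ler0n.
apply: le_trans (ler_pM h00 (exprn_ge0 _ r0) h1 h2) _.
rewrite exprVn -exprM (mulSn 8) exprD invfM mulrCA divff ?mulr1; last first.
  by rewrite expf_neq0 // lt0r_neq0.
rewrite lef_pV2 ?posrE ?exprn_gt0 ?ltr0n //.
by rewrite -[X in X <= _]expr1 ler_eXn2l.
Qed.

(** One attempt: [#|I|] steps pass from averages over all permutations to sums over even ones, and
    [W * #|I|] further steps contain the [J] uniform ones up to a loss of one half. The constant
    lies below [1/2 * 7/64 * a^2/128 * 1/2]. *)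
Lemma walk_gain k W c v g : (1 < k)%N -> (32 * k <= #|I|)%N -> (#|I| <= 64 * k)%N ->
  (1 - a ^+ 2 / 2) ^+ W <= (2 ^+ 9)^-1 ->
  0 <= c -> (forall x, 0 <= v x) -> mixing false k c v ->
  a ^+ 2 / 64%:R / 128%:R * c <= iter (W * #|I| + #|I|) (walk p) v g.
Proof.
move=> k1 kN Nk HW c0 v0 Hv.
have [J JN HJ] := unif_walk_ge R I0.
pose N := #|I|%:R : R.
have a2 : 0 < a ^+ 2 by rewrite exprn_gt0.
have a21 : a ^+ 2 <= 1 by rewrite exprn_ile1 // ltW.
have kR : 64%:R * (k%:R - 1) >= 2^-1 * N.
  have : (#|I|%:R : R) <= (64 * k)%:R by rewrite ler_nat.
  have : (2%:R : R) <= k%:R by rewrite ler_nat.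
  by rewrite natrM /N; lra.
have kR2 : 32%:R * k%:R <= N by rewrite -natrM ler_nat.
pose q := 2 * (k - 1)%:R * e ^+ 2.
have kB : ((k - 1)%:R : R) = k%:R - 1 by rewrite natrB // ltnW.
have qN : a ^+ 2 / 64%:R <= #|I|%:R * q.
  rewrite /q eE kB expr_div_n -/N.
  have -> : N * (2 * (k%:R - 1) * (a ^+ 2 / N ^+ 2)) = a ^+ 2 * (2 * (k%:R - 1) / N).
    by field; apply: lt0r_neq0.
  apply: ler_wpM2l; first exact: ltW.
  by rewrite ler_pdivlMr //; lra.
have q0 : 0 <= q by rewrite !mulr_ge0 ?ler0n ?sqr_ge0.
have q1 : q <= 1.
  rewrite /q eE kB expr_div_n -/N mulrA ler_pdivrMr ?exprn_gt0 // mul1r.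
  have h1 : (k%:R : R) - 1 <= N by lra.
  have hN : 1 <= N by rewrite ler1n.
  have h2 : 2 * (k%:R - 1) <= N by lra.
  have h3 : 0 <= 2 * ((k%:R : R) - 1) by rewrite -kB mulr_ge0 ?ler0n.
  apply: le_trans (ler_pM h3 (ltW a2) h2 a21) _.
  by rewrite mulr1 expr2 -[X in X <= _]mulr1; apply: ler_wpM2l => //; apply: ltW.
(* Bernoulli's inequality; with [#|I| * q >= a^2 / 64] it yields [1 - y >= a^2 / 128]. *)
have bern n : (1 - q) ^+ n * (1 + n%:R * q) <= 1.
  elim: n => [|n IHn]; first by rewrite expr0 mul0r addr0 mulr1.
  apply: le_trans IHn; rewrite exprSr -mulrA; apply: ler_wpM2l.
    by rewrite exprn_ge0 // subr_ge0.
  rewrite -natr1; have : 0 <= (n%:R + 1) * q ^+ 2 by rewrite mulr_ge0 ?sqr_ge0 // addr_ge0 ?ler0n.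
  by rewrite !mulrDl !mulrDr; lra.
pose y := (1 - q) ^+ #|I|.
have y0 : 0 <= y by rewrite exprn_ge0 // subr_ge0.
have yb : 1 - y >= a ^+ 2 / 128%:R.
  have := bern #|I|; rewrite -/y.
  have : y * (1 + a ^+ 2 / 64%:R) <= y * (1 + #|I|%:R * q).
    by apply: ler_wpM2l => //; lra.
  move=> h1 h2; have h3 := le_trans h1 h2.
  have [//|h4] := leP (a ^+ 2 / 128%:R) (1 - y).
  have h5 : 1 - a ^+ 2 / 128%:R <= y by lra.
  have h6 : (1 - a ^+ 2 / 128%:R) * (1 + a ^+ 2 / 64%:R) <= 1.
    by apply: le_trans h3; apply: ler_wpM2r => //; lra.
  move: h6; move: (a ^+ 2) a2 a21 => b b0 b1 h6; nra.
pose c' := (1 - y) * (c / 2); pose v' := iter #|I| (walk p) v.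
have c'0 : 0 <= c' by rewrite mulr_ge0 //; lra.
have v'0 x : 0 <= v' x by apply: iter_walk_ge.
have Hv' : mixing true k c' v' by apply: mixing_even.
rewrite iterD -/v'.
have C0 : 0 <= 7%:R / 64%:R * c' by lra.
have := @iter_walk_ge_unif J (7%:R / 64%:R * c') v' C0 v'0 _ (W * #|I|)%N J g (leqnn J).
rewrite subnn => H.
apply: le_trans (_ : (1 - 2 ^+ J * (1 - a ^+ 2 / 2) ^+ (W * #|I|)) * (7%:R / 64%:R * c') <= _); last first.
  apply: H => s h; apply: (HJ k) => //; last exact: mixing_iter_walk.
  by move=> x; apply: iter_walk_ge.
have rho0 : 0 <= 1 - a ^+ 2 / 2 by lra.
have half := pow_budget JN I0 rho0 HW.
have hc : a ^+ 2 / 128%:R * (c / 2) <= c' by apply: ler_wpM2r => //; lra.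
have : 2^-1 * (7%:R / 64%:R * c') <= (1 - 2 ^+ J * (1 - a ^+ 2 / 2) ^+ (W * #|I|)) * (7%:R / 64%:R * c').
  by apply: ler_wpM2r => //; lra.
apply: le_trans.
have : 0 <= a ^+ 2 * c by rewrite mulr_ge0 // ltW.
move: (a ^+ 2) hc => b hc h; lra.
Qed.

(** After subtraction of the minimum [m] guaranteed so far, the function is nonnegative and still
    mixing, with constant [c - m]. Each attempt therefore removes the same proportion of the
    deficit. *)
Lemma iter_walk_gain k W c v K g : (1 < k)%N -> (32 * k <= #|I|)%N -> (#|I| <= 64 * k)%N ->
  (1 - a ^+ 2 / 2) ^+ W <= (2 ^+ 9)^-1 ->
  0 <= c -> (forall x, 0 <= v x) -> mixing false k c v ->
  (1 - (1 - a ^+ 2 / 64%:R / 128%:R) ^+ K) * c <=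
    iter (K * (W * #|I| + #|I|)) (walk p) v g.
Proof.
move=> k1 kN Nk HW c0 v0 Hv.
have a2 : 0 < a ^+ 2 by rewrite exprn_gt0.
have a21 : a ^+ 2 <= 1 by rewrite exprn_ile1 // ltW.
elim: K g => [|K IH] g; first by rewrite expr0 subrr mul0r; apply: v0.
set y := _ ^+ K in IH; set m := (1 - y) * c in IH.
have y0 : 0 <= y by rewrite exprn_ge0 //; lra.
rewrite mulSn iterD; set u := iter _ _ v in IH *.
have Hu : mixing false k c u by apply: mixing_iter_walk.
have cm : c - m = y * c by rewrite /m; ring.
have := @walk_gain k W (c - m) (fun x => u x - m) g k1 kN Nk HW _ _ _.
rewrite iter_walkB // cm => H.
suff : a ^+ 2 / 64%:R / 128%:R * (y * c) <= iter (W * #|I| + #|I|) (walk p) u g - m.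
  by rewrite [(1 - _) ^+ K.+1]exprS -/y /m; lra.
apply: H; first exact: mulr_ge0.
  by move=> x; rewrite subr_ge0.
move=> M h kM; rewrite /symsum sumrB sumr_const.
have -> : m *+ #|[pred h : {perm I} | perm_on M h && (false ==> ~~ odd_perm h)]| = m * #|M|`!%:R.
  rewrite -mulr_natr -card_perm; congr (_ * _%:R); apply: eq_card => x.
  by rewrite !inE andbT.
have := Hu M h kM; rewrite /symsum => {}Hu.
by move: cm Hu; move: (\sum_(i | _) _) => S cm Hu; rewrite -cm mulrBl; lra.
Qed.

End Early.

(** * The biased walk *)

Section Biased.
Variables (R : realFieldType) (I : finType) (A : {set I}) (n : nat) (a : R).
Hypotheses (n0 : (0 < n)%N) (cI : #|I| = (2 * n)%N) (cA : #|A| = n).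
Hypotheses (a0 : 0 < a) (a1 : a <= 1).
Implicit Types (M T : {set I}) (g : {perm I}).

Local Notation N := (#|I|%:R : R).

Definition bias (c : I) : R := (if c \in A then a else 2 - a) / N.

Let NE : N = 2 * n%:R. Proof. by rewrite cI natrM. Qed.
Let N0 : 0 < N. Proof. by rewrite ltr0n cI muln_gt0. Qed.
Let I0 : (0 < #|I|)%N. Proof. by rewrite cI muln_gt0. Qed.
Let nN : N != 0. Proof. exact: lt0r_neq0. Qed.

Lemma sum_type (S : {set I}) (X Y : R) :
  \sum_(c in S) (if c \in A then X else Y) = #|S :&: A|%:R * X + #|S :&: ~: A|%:R * Y.
Proof.
rewrite (bigID (mem A)) /= !mulr_natl -!sumr_const; congr (_ + _).
  by apply: eq_big => [c|c /andP[_ ->]] //; rewrite inE.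
by apply: eq_big => [c|c /andP[_ /negPf->]] //; rewrite !inE.
Qed.

Lemma distr_bias : distr bias.
Proof.
have [ha0 ha1] := (a0, a1).
split=> [c|]; first by apply: divr_ge0; [case: ifP => _; lra | exact: ltW].
have -> : \sum_i bias i = \sum_(i in [set: I]) (if i \in A then a / N else (2 - a) / N).
  by apply: eq_big => [c|c _]; rewrite ?inE // /bias; case: ifP.
rewrite sum_type !setTI cA.
have -> : #|~: A| = n by have := cardsC A; rewrite cI cA; lia.
by rewrite NE; field; rewrite pnatr_eq0 -lt0n.
Qed.

Lemma bias_ge c : a / N <= bias c.
Proof.
have [ha0 ha1] := (a0, a1).
by apply: ler_wpM2r; [rewrite invr_ge0 ltW | case: ifP => _; lra].
Qed.

Lemma card_insert T M c : c \notin M ->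
  #|~: M :&: T|%:R = #|~: (c |: M) :&: T|%:R + (c \in T)%:R :> R.
Proof.
move=> cM; rewrite (cardsD1 c (~: M :&: T)) !inE cM /= natrD addrC; congr (_%:R + _).
by apply: eq_card => y; rewrite !inE; case: eqP => //= _; rewrite andbC.
Qed.

Lemma card_swap T M c m : c \notin M -> m \in M ->
  #|~: ((c |: M) :\ m) :&: T|%:R = #|~: M :&: T|%:R - (c \in T)%:R + (m \in T)%:R :> R.
Proof.
move=> cM mM; rewrite (card_insert T cM) addrK.
rewrite (@card_insert T ((c |: M) :\ m) m) ?inE ?eqxx //.
by rewrite setD1K // !inE mM orbT.
Qed.

Lemma card_unmarked M : #|~: M :&: A|%:R + #|~: M :&: ~: A|%:R + #|M|%:R = N.
Proof.
rewrite -!natrD; congr (_%:R); rewrite -(cardsC M) [RHS]addnC; congr (_ + _)%N.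
by rewrite -[RHS](cardsID A) setDE.
Qed.

Lemma card_markedB M : #|M :&: ~: A|%:R = n%:R - #|~: M :&: ~: A|%:R :> R.
Proof.
apply/eqP; rewrite eq_sym subr_eq -natrD eqr_nat; apply/eqP.
have -> : n = #|~: A| by have := cardsC A; rewrite cI cA; lia.
by rewrite -(cardsID M (~: A)) setIC; congr (_ + _)%N; apply: eq_card => y; rewrite !inE.
Qed.

(** * Drift of the potential of the unmarked cards *)

Section Potential.
Variables (C d : R).
Hypotheses (C1 : 1 <= C) (d0 : 0 <= d) (dC : 1 - a <= d * C).

Definition pot M : R := N * (C * #|~: M :&: A|%:R + #|~: M :&: ~: A|%:R) / #|M|%:R.

(** Twice [bias c] times the least weight [a / N], so the excess [2 * bias c * bias m - rate c]
    vanishes for an a-card [m]. *)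
Definition rate (c : I) : R := 2 * a * bias c / N.

(* Writing [al], [be] for the numbers of unmarked cards of the two types, the
   [al * be] terms cancel and the drift is exactly
   [2 * a / #|M| * ((C - 1 + a) * al + (2 - a) * be)]. *)
Lemma potential_drift M : (0 < #|M|)%N ->
  2 * a * (1 - d) / N * pot M <=
     \sum_(c in ~: M) rate c * #|M|.+1%:R * (pot M - pot (c |: M))
   + \sum_(c in ~: M) \sum_(m in M)
        (2 * bias c * bias m - rate c) * (pot M - pot ((c |: M) :\ m)).
Proof.
have [ha0 ha1 hC1 hd0] := And4 a0 a1 C1 d0.
move=> M0; pose k := #|M|%:R : R.
have k0 : 0 < k by rewrite ltr0n.
have kn : k != 0 by apply: lt0r_neq0.
have k1n : k + 1 != 0 by rewrite lt0r_neq0 // ltr_wpDr.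
pose al := #|~: M :&: A|%:R : R; pose be := #|~: M :&: ~: A|%:R : R.
pose D := C * al + be.
have kE : k = N - al - be by rewrite -(card_unmarked M) /al /be /k; ring.
have k1E : #|M|.+1%:R = k + 1 by rewrite /k natr1.
have S1 : \sum_(c in ~: M) rate c * #|M|.+1%:R * (pot M - pot (c |: M)) =
  al * (2 * a * a / N * (D + C * k) / k) + be * (2 * a * (2 - a) / N * (D + k) / k).
  rewrite -sum_type; apply: eq_bigr => c; rewrite inE => cM.
  have pE : pot (c |: M) = N * (C * (al - (c \in A)%:R) + (be - (c \in ~: A)%:R)) / (k + 1).
    rewrite /pot cardsU1 cM add1n k1E /al /be (card_insert A cM) (card_insert (~: A) cM).
    by rewrite !addrK.
  rewrite pE /pot -/al -/be -/k k1E /rate /bias inE /D; case: ifP => _ /=;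
    by field; rewrite kn nN k1n.
(* Only exchanges of an unmarked a-card with a marked b-card contribute; each lowers the weighted
   count by [C - 1]. *)
have S2 : \sum_(c in ~: M) \sum_(m in M)
        (2 * bias c * bias m - rate c) * (pot M - pot ((c |: M) :\ m)) =
  al * ((n%:R - be) * (2 * a * (2 - 2 * a) / N * (C - 1) / k)).
  rewrite -[RHS]addr0 -[X in _ = _ + X](mulr0 be) -sum_type; apply: eq_bigr => c; rewrite inE => cM.
  transitivity (\sum_(m in M) (if m \in A then 0 : R else
      if c \in A then 2 * a * (2 - 2 * a) / N * (C - 1) / k else 0)).
    apply: eq_bigr => m mM.
    have cs : #|(c |: M) :\ m|%:R = k.
      by rewrite -(preim_tperm_swap cM mM) card_preim_perm.
    rewrite /pot cs (card_swap A cM mM) (card_swap (~: A) cM mM) -/al -/be -/k !inE.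
    rewrite /rate /bias; case: (m \in A); case: (c \in A) => /=;
      by field; rewrite ?kn ?nN.
  rewrite sum_type mulr0 add0r card_markedB -/be; case: ifP => _ //; by rewrite mulr0.
rewrite S1 S2 /pot -/al -/be -/k -/D.
have nE : n%:R = N / 2 by rewrite NE; field.
rewrite nE -subr_ge0.
(* The coefficient of [al] is nonnegative exactly by [1 - a <= d * C]. *)
have -> : al * (2 * a * a / N * (D + C * k) / k) + be * (2 * a * (2 - a) / N * (D + k) / k) +
   al * ((N / 2 - be) * (2 * a * (2 - 2 * a) / N * (C - 1) / k)) -
   2 * a * (1 - d) / N * (N * D / k) =
   2 * a / k * (al * (d * C - (1 - a)) + be * (1 - a + d)).
  have NE2 : N = k + al + be by rewrite kE; ring.
  have hN := nN; rewrite NE2 in hN *; rewrite /D.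
  by move: k al be {NE2} kn hN {D S1 S2 k0 k1n kE k1E} => k al be kn hN; field; rewrite kn hN.
have al0 : 0 <= al by apply: ler0n.
have be0 : 0 <= be by apply: ler0n.
apply: mulr_ge0; first by rewrite !mulr_ge0 ?invr_ge0 // ltW.
by apply: addr_ge0; apply: mulr_ge0 => //; [rewrite subr_ge0 | lra].
Qed.

Lemma pot_setT : pot [set: I] = 0.
Proof. by rewrite /pot setCT !set0I !cards0 mulr0 addr0 mulr0 mul0r. Qed.

Lemma pot_ge0 M : 0 <= pot M.
Proof.
have C0 : 0 <= C by apply: le_trans C1; apply: ler01.
by rewrite /pot divr_ge0 ?ler0n // mulr_ge0 ?ler0n // addr_ge0 ?ler0n // mulr_ge0 ?ler0n.
Qed.

Lemma pot_ge1 M : M != [set: I] -> (0 < #|M|)%N -> 1 <= pot M.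
Proof.
move=> MT M0; rewrite /pot ler_pdivlMr ?ltr0n // mul1r.
have MI : #|M|%:R <= N by rewrite ler_nat max_card.
apply: le_trans MI _; rewrite -[X in X <= _]mulr1; apply: ler_wpM2l; first exact: ltW.
have : 1 <= #|~: M :&: A|%:R + #|~: M :&: ~: A|%:R :> R.
  rewrite -natrD ler1n -setDE cardsID card_gt0; apply: contraNneq MT => E.
  by rewrite -(setCK M) E setC0.
have : 0 <= #|~: M :&: A|%:R :> R by apply: ler0n.
have hC1 := C1; move: (#|~: M :&: A|%:R : R) (#|~: M :&: ~: A|%:R : R) => x y x0 xy; nra.
Qed.

Lemma pot_le M : (0 < #|M|)%N -> pot M <= C * N ^+ 2 / #|M|%:R.
Proof.
move=> M0; apply: ler_wpM2r; first by rewrite invr_ge0 ler0n.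
rewrite expr2 mulrCA; apply: ler_wpM2l; first exact: ltW.
have := card_unmarked M; have hC1 := C1.
have : 0 <= #|M|%:R :> R by apply: ler0n.
have : 0 <= #|~: M :&: ~: A|%:R :> R by apply: ler0n.
move: (#|~: M :&: A|%:R : R) (#|~: M :&: ~: A|%:R : R) (#|M|%:R : R) => x y k y0 k0 <-; nra.
Qed.

(** Sets of size at least [k] have potential at most [64 * C * N]. The bound [2 * N <= a * k^2]
    keeps the total marking rate, at most [2 * a / N], below the squared marked weight, at least
    [(a * k / N)^2]. *)
Lemma biased_mixing s k (rho := 1 - 2 * a * (1 - d) / N) :
  d <= 1 -> (0 < k)%N -> 2 * N <= a * k%:R ^+ 2 -> (#|I| <= 64 * k)%N ->
  mixing false k ((1 - rho ^+ s * (64%:R * C * N)) / #|I|`!%:R)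
    (iter s (walk bias) (@dirac R I)).
Proof.
move=> d1 k0 kk Nk M g kM; have M0 : (0 < #|M|)%N by apply: leq_trans kM.
have [ha0 ha1 hC1 hd0] := And4 a0 a1 C1 d0.
have f0 : 0 < #|M|`!%:R :> R by apply: fact_gt0R.
rewrite -ler_pdivlMr // -/(symavg M _ g).
have N2 : 2 <= N by rewrite NE ler_peMr // ler1n.
have rho0 : 0 <= rho.
  rewrite subr_ge0 ler_pdivrMr // mul1r.
  have : a * (1 - d) <= 1 * 1 by apply: ler_pM => //; lra.
  by lra.
apply: le_trans (@iter_walk_symavg_ge R I bias pot (fun=> rate) k rho s M g
  distr_bias _ _ _ pot_ge0 pot_setT _ rho0 _ kM).
- apply: ler_wpM2r; first by rewrite invr_ge0 ltW // fact_gt0R.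
  rewrite lerD2l lerN2; apply: ler_wpM2l; first exact: exprn_ge0.
  apply: le_trans (pot_le M0) _; rewrite ler_pdivrMr ?ltr0n //.
  rewrite [X in X <= _](_ : _ = C * N * N); last by ring.
  rewrite [X in _ <= X](_ : _ = C * N * (64%:R * #|M|%:R)); last by ring.
  apply: ler_wpM2l; first by rewrite mulr_ge0 ?ler0n //; lra.
  by rewrite -natrM ler_nat; apply: leq_trans Nk _; rewrite leq_mul2l kM orbT.
- move=> _ c; rewrite /rate; apply: divr_ge0; last exact: ltW.
  by apply: mulr_ge0; [lra | have [b _] := distr_bias; apply: b].
- move=> _ c m _ _ _.
  have -> : rate c = 2 * bias c * (a / N) by rewrite /rate; ring.
  apply: ler_wpM2l; last exact: bias_ge.
  by apply: mulr_ge0 => //; have [b _] := distr_bias; apply: b.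
- move=> M' kM'.
  have pM : a * k%:R / N <= \sum_(m in M') bias m.
    apply: le_trans (_ : \sum_(m in M') a / N <= _); last by apply: ler_sum => m _; apply: bias_ge.
    rewrite sumr_const -[X in _ <= X]mulr_natr [X in X <= _]mulrAC.
    apply: ler_wpM2l; last by rewrite ler_nat.
    by rewrite divr_ge0 // ltW.
  have p0 : 0 <= a * k%:R / N by rewrite divr_ge0 ?ler0n // mulr_ge0 ?ler0n // ltW.
  apply: le_trans (_ : (a * k%:R / N) ^+ 2 <= _); last first.
    by apply: lerXn2r; rewrite ?nnegrE //; apply: le_trans pM.
  have [b0 b1] := distr_bias.
  apply: le_trans (_ : 2 * a / N <= _).
    have -> : \sum_(c in ~: M') rate c = 2 * a / N * \sum_(c in ~: M') bias c.
      by rewrite mulr_sumr; apply: eq_bigr => c _; rewrite /rate mulrAC.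
    rewrite -[X in _ <= X]mulr1; apply: ler_wpM2l; first by rewrite divr_ge0 ?ler0n //; lra.
    rewrite -b1 [X in _ <= X](bigID (mem (~: M'))) /= lerDl; exact: sumr_ge0.
  have -> : (a * k%:R / N) ^+ 2 = a / N * (a * k%:R ^+ 2) / N by field.
  rewrite ler_pdivlMr //.
  have -> : 2 * a / N * N = a / N * (2 * N) by field.
  by apply: ler_wpM2l => //; rewrite divr_ge0 // ltW.
- by move=> M' MT kM'; apply: pot_ge1 => //; apply: leq_trans kM'.
- move=> M' kM'; rewrite /rho opprB addrCA subrr addr0.
  by apply: potential_drift; apply: leq_trans kM'.
Qed.

Lemma biased_sep_le s K W k g (rho := 1 - 2 * a * (1 - d) / N) :
  d <= 1 -> (1 < k)%N -> (32 * k <= #|I|)%N -> (#|I| <= 64 * k)%N -> 2 * N <= a * k%:R ^+ 2 ->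
  (1 - a ^+ 2 / 2) ^+ W <= (2 ^+ 9)^-1 ->
  rho ^+ s * (64%:R * C * N) <= 1 ->
  (1 - (1 - a ^+ 2 / 64%:R / 128%:R) ^+ K) *
     ((1 - rho ^+ s * (64%:R * C * N)) / #|I|`!%:R) <=
    iter (K * (W * #|I| + #|I|) + s) (walk bias) (@dirac R I) g.
Proof.
move=> d1 k1 kN Nk kk HW hs; rewrite iterD.
have e0 : 0 <= a / N by rewrite divr_ge0 // ltW.
apply: (@iter_walk_gain R I bias (a / N) distr_bias e0 bias_ge I0 a a0 a1 erefl k) => //.
- by rewrite divr_ge0 ?ler0n // subr_ge0.
- by move=> x; apply: iter_dirac_ge0 distr_bias.
- by apply: biased_mixing => //; apply: ltnW.
Qed.

End Potential.

(** A crude bound for every positive [n], from which a mixing time exists. Marking starts with a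
    single card, where the average is the value itself; the small rate [x] is admissible for all
    nonempty sets, and exchanges leave [V] unchanged. *)
Lemma biased_sep_weak s g :
  (1 - (1 - a ^+ 3 / N ^+ 2) ^+ s * N ^+ 2) / #|I|`!%:R <=
    iter s (walk bias) (@dirac R I) g.
Proof.
have [ha0 ha1] := (a0, a1).
have [b0 b1] := distr_bias.
have N1 : 1 <= N by rewrite ler1n.
have aN : a / N <= 1 by rewrite ler_pdivrMr // mul1r; lra.
have aN0 : 0 < a / N by rewrite divr_gt0.
pose V M : R := N * #|~: M|%:R / #|M|%:R.
pose x (M : {set I}) c : R := bias c * (a / N) ^+ 2.
pose rho : R := 1 - a ^+ 3 / N ^+ 2.
have /card_gt0P[i0 _] := I0.
have cm M : #|~: M|%:R + #|M|%:R = N :> R by rewrite -natrD addnC cardsC.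
have cU M c : c \notin M -> #|~: (c |: M)|%:R = #|~: M|%:R - 1 :> R.
  move=> cM; apply/eqP; rewrite eq_sym subr_eq natr1 eqr_nat (cardsD1 c (~: M)) inE cM add1n eqSS.
  by apply/eqP; apply: eq_card => y; rewrite !inE negb_or.
have := @iter_walk_symavg_ge R I bias V x 1 rho s [set i0] g distr_bias _ _ _ _ _ _ _ _ _.
rewrite /symavg cards1 divr1 /symsum (eq_bigl (pred1 1%g)) => [|h]; last first.
  rewrite andbT; apply/idP/eqP => [/perm_on_id-> //|->]; first by rewrite cards1.
  exact: perm_on1.
rewrite big_pred1_eq mul1g => H.
apply: le_trans (H _ _ _ _ _ _ _ _ _); rewrite ?cards1 //.
- apply: ler_wpM2r; first by rewrite invr_ge0 ler0n.
  rewrite lerD2l lerN2; apply: ler_wpM2l.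
    rewrite exprn_ge0 // subr_ge0 ler_pdivrMr ?exprn_gt0 // mul1r.
    apply: le_trans (_ : 1 <= _); last by rewrite exprn_ege1.
    by rewrite exprn_ile1 // ltW.
  rewrite /V cards1 divr1 expr2; apply: ler_wpM2l; first exact: ltW.
  by rewrite ler_nat max_card.
- by move=> M c; rewrite /x mulr_ge0 // sqr_ge0.
- move=> M c m _ _ _; rewrite /x; have -> : 2 * bias c * bias m = bias c * (2 * bias m) by ring.
  apply: ler_wpM2l => //.
  apply: le_trans (_ : 1 * (a / N) <= _).
    by rewrite expr2; apply: ler_wpM2r => //; apply: ltW.
  by have := bias_ge m; rewrite mul1r; lra.
- move=> M kM; apply: le_trans (_ : (a / N) ^+ 2 <= _).
    rewrite -mulr_suml -[X in _ <= X]mul1r; apply: ler_wpM2r; first exact: sqr_ge0.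
    by rewrite -b1 [X in _ <= X](bigID (mem (~: M))) /= lerDl; apply: sumr_ge0.
  have /card_gt0P[m mM] := kM.
  apply: lerXn2r; rewrite ?nnegrE ?sumr_ge0 //; first exact: ltW.
  apply: le_trans (bias_ge m) _; rewrite (bigD1 m) //= lerDl; exact: sumr_ge0.
- by move=> M; rewrite /V divr_ge0 ?mulr_ge0 ?ler0n.
- by rewrite /V setCT cards0 mulr0 mul0r.
- move=> M MT kM; rewrite /V ler_pdivlMr ?ltr0n // mul1r.
  apply: le_trans (_ : N * 1 <= _); first by rewrite mulr1 ler_nat max_card.
  apply: ler_wpM2l; first exact: ltW.
  rewrite ler1n card_gt0; apply: contraNneq MT => E.
  by rewrite -(setCK M) E setC0.
- rewrite /rho subr_ge0 ler_pdivrMr ?exprn_gt0 // mul1r.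
  apply: le_trans (_ : 1 <= _); last by rewrite exprn_ege1.
  by rewrite exprn_ile1 // ltW.
move=> M kM; pose k := #|M|%:R : R.
have k0 : 0 < k by rewrite ltr0n.
have kn : k != 0 by apply: lt0r_neq0.
have k1n : k + 1 != 0 by rewrite lt0r_neq0 // ltr_wpDr.
rewrite [X in _ <= _ + X]big1 ?addr0 => [|c]; last first.
  rewrite inE => cM; rewrite big1 // => m mM; rewrite /V.
  have -> : #|~: ((c |: M) :\ m)| = #|~: M|.
    have := cardsC ((c |: M) :\ m); have := cardsC M.
    rewrite -(preim_tperm_swap cM mM) card_preim_perm => e1 e2.
    by apply: (@addnI #|M|); rewrite e2.
  by rewrite -(preim_tperm_swap cM mM) card_preim_perm subrr mulr0.
apply: le_trans (_ : \sum_(c in ~: M) a / N * (a / N) ^+ 2 * (N ^+ 2 / k) <= _).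
  rewrite sumr_const -mulr_natl /rho /V -/k opprB addrCA subrr addr0 le_eqVlt.
  by apply/orP; left; apply/eqP; field; rewrite kn nN.
apply: ler_sum => c; rewrite inE => cM.
have -> : x M c * #|M|.+1%:R * (V M - V (c |: M)) = bias c * (a / N) ^+ 2 * (N ^+ 2 / k).
  rewrite /V /x cardsU1 cM add1n -natr1 -/k cU //.
  have <- := cm M; rewrite -/k.
  have hN : #|~: M|%:R + k != 0 by rewrite cm nN.
  by field; rewrite kn k1n hN.
apply: ler_wpM2r; first by rewrite divr_ge0 ?sqr_ge0 // ltW.
by apply: ler_wpM2r; [apply: sqr_ge0 | apply: bias_ge].
Qed.

End Biased.

(** * Untouched cards *)

Section Untouched.
Variables (R : realFieldType) (I : finType) (p : I -> R) (A : {set I}) (e : R).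
Hypotheses (dp : distr p) (pA : forall i, i \in A -> p i = e).
Implicit Types (D : {set I}) (g : {perm I}).

Definition deranges (g : {perm I}) := [forall (c | c \in A), g c != c].

Definition nofix g : R := (deranges g)%:R.

Lemma sum_avoid (S : pred I) (s : R) : \sum_(i | S i) p i = s ->
  \sum_r \sum_l p r * p l * ((~~ S r)%:R * (~~ S l)%:R) = (1 - s) ^+ 2.
Proof.
move=> Ss; have [p0 p1] := dp.
have E : \sum_r p r * (~~ S r)%:R = 1 - s.
  rewrite -[X in _ = X - _]p1 [X in _ = X - _](bigID S) /= Ss [X in _ = X - _]addrC addrK [RHS]big_mkcond.
  by apply: eq_bigr => i _; case: (S i); rewrite ?mulr0 ?mulr1.
rewrite expr2 -E mulr_suml; apply: eq_bigr => r _.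
by rewrite mulr_sumr; apply: eq_bigr => l _; ring.
Qed.

Lemma card_sumR D : #|D|%:R = \sum_(c in D) 1 :> R.
Proof. by rewrite sumr_const. Qed.

Lemma untouched_mean D : D \subset A ->
  \sum_r \sum_l p r * p l * #|D :\: [set r; l]|%:R = (1 - e) ^+ 2 * #|D|%:R.
Proof.
move=> DA; have E r l : #|D :\: [set r; l]|%:R =
    \sum_(c in D) ((r != c)%:R * (l != c)%:R) :> R.
  rewrite card_sumR big_mkcond [RHS]big_mkcond; apply: eq_bigr => c _.
  rewrite !inE negb_or (eq_sym c r) (eq_sym c l).
  by case: (c \in D); case: (r == c); case: (l == c); rewrite /= ?mulr0 ?mul0r ?mulr1.
under eq_bigr do under eq_bigr do rewrite E mulr_sumr.
under eq_bigr do rewrite exchange_big /=.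
rewrite exchange_big /= mulr_natr -sumr_const; apply: eq_bigr => c cD.
rewrite (@sum_avoid (pred1 c) e) // big_pred1_eq pA //; exact: (subsetP DA).
Qed.

(** Second factorial moment: both hands miss two given distinct cards of [D] with probability
    [(1 - 2 * e) ^+ 2]. *)
Lemma untouched_pairs D : D \subset A ->
  \sum_r \sum_l p r * p l * (#|D :\: [set r; l]|%:R * (#|D :\: [set r; l]|%:R - 1)) =
  (1 - 2 * e) ^+ 2 * (#|D|%:R * (#|D|%:R - 1)).
Proof.
move=> DA.
have E (B : {set I}) : B \subset D -> #|B|%:R * (#|B|%:R - 1) =
   \sum_(c in D) \sum_(d in D | d != c) ((c \in B)%:R * (d \in B)%:R) :> R.
  move=> BD.
  have S1 : \sum_(c in D) (c \in B)%:R = #|B|%:R :> R.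
    rewrite card_sumR [RHS]big_mkcond [LHS]big_mkcond; apply: eq_bigr => c _.
    by case: (boolP (c \in B)) => [cB|_]; [rewrite (subsetP BD c cB) | case: ifP].
  transitivity (\sum_(c in D) (c \in B)%:R * (#|B|%:R - (c \in B)%:R) : R).
    under eq_bigr do rewrite mulrBr; rewrite sumrB -mulr_suml S1.
    rewrite mulrBr mulr1; congr (_ - _); rewrite -S1; apply: eq_bigr => c _.
    by case: (_ \in _); rewrite ?mulr0 ?mulr1.
  apply: eq_bigr => c cD; rewrite -mulr_sumr; congr (_ * _).
  by rewrite -S1 (bigD1 c) //= addrC addrK.
have sub r l : D :\: [set r; l] \subset D by apply: subsetDl.
under eq_bigr do under eq_bigr do rewrite E // mulr_sumr.
under eq_bigr do rewrite exchange_big /=.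
rewrite exchange_big /= (E D) // mulr_sumr; apply: eq_bigr => c cD.
under eq_bigr do under eq_bigr do rewrite mulr_sumr.
under eq_bigr do rewrite exchange_big /=.
rewrite exchange_big /= mulr_sumr; apply: eq_bigr => d /andP[dD dc].
rewrite cD dD !mulr1 -(@sum_avoid (pred2 c d)); last first.
  rewrite (bigD1 c) ?inE ?eqxx //= (bigD1 d) ?inE ?eqxx ?orbT //= big1 => [|i]; last first.
    by case/andP => /andP[/orP[/eqP->|/eqP->]]; rewrite eqxx // andbF.
  rewrite !pA ?(subsetP DA) // addr0; ring.
apply: eq_bigr => r _; apply: eq_bigr => l _; congr (_ * _).
rewrite !inE cD dD !andbT !negb_or /= (eq_sym c r) (eq_sym c l) (eq_sym d r) (eq_sym d l).
by case: (r == c); case: (l == c); case: (r == d); case: (l == d); rewrite /= ?mulr0 ?mul0r ?mulr1.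
Qed.

(* The mean of [(X / mu - 1) ^+ 2], where [X] is the number of cards of [D] not
   touched during [t] steps. *)
Definition chebyshev (mu : R) t D : R :=
  1 - 2 * ((1 - e) ^+ 2) ^+ t * #|D|%:R / mu
  + (((1 - e) ^+ 2) ^+ t * #|D|%:R + ((1 - 2 * e) ^+ 2) ^+ t * (#|D|%:R * (#|D|%:R - 1))) / mu ^+ 2.

(** [D] consists of cards still in place. If no a-card is fixed at the end, none of [D] is untouched
    and the squared deviation equals 1; otherwise it is nonnegative. By the two moment identities
    [chebyshev] satisfies the one-step recursion exactly. *)
Lemma nofix_le mu t D g : 0 < mu -> D \subset A -> (forall c, c \in D -> g c = c) ->
  iter t (walk p) nofix g <= chebyshev mu t D.
Proof.
move=> mu0; have mun : mu != 0 by apply: lt0r_neq0.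
have [p0 p1] := dp.
elim: t D g => [|t IH] D g DA gD.
  have -> : chebyshev mu 0 D = ((#|D|%:R - mu) / mu) ^+ 2 by rewrite /chebyshev; field.
  have [->|/set0Pn[c cD]] := eqVneq D set0.
    rewrite cards0 sub0r mulNr divff // sqrrN expr1n /= /nofix.
    by rewrite lern1 leq_b1.
  rewrite /= /nofix (_ : deranges g = false) ?sqr_ge0 //.
  apply/negbTE; rewrite negb_forall; apply/existsP; exists c.
  by rewrite negb_imply (subsetP DA) // negbK gD // eqxx.
rewrite /=; apply: le_trans (_ : \sum_r \sum_l p r * p l * chebyshev mu t (D :\: [set r; l]) <= _).
  apply: ler_sum => r _; apply: ler_sum => l _; apply: ler_wpM2l; first exact: mulr_ge0.
  apply: IH; first by apply: subset_trans (subsetDl _ _) DA.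
  move=> c; rewrite !inE negb_or => /andP[/andP[cr cl] cD].
  by rewrite permM tpermD ?gD // eq_sym.
set q1 := (1 - e) ^+ 2; set q2 := (1 - 2 * e) ^+ 2.
have -> : \sum_r \sum_l p r * p l * chebyshev mu t (D :\: [set r; l]) =
  \sum_r \sum_l p r * p l
  + (q1 ^+ t / mu ^+ 2 - 2 * q1 ^+ t / mu) * (\sum_r \sum_l p r * p l * #|D :\: [set r; l]|%:R)
  + q2 ^+ t / mu ^+ 2 * (\sum_r \sum_l p r * p l * (#|D :\: [set r; l]|%:R * (#|D :\: [set r; l]|%:R - 1))).
  rewrite !mulr_sumr -!big_split; apply: eq_bigr => r _ /=.
  rewrite !mulr_sumr -!big_split; apply: eq_bigr => l _ /=.
  by rewrite /chebyshev -/q1 -/q2; ring.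
rewrite distr_pair // untouched_mean // untouched_pairs // -/q1 -/q2 /chebyshev -/q1 -/q2.
rewrite [q1 ^+ t.+1]exprS [q2 ^+ t.+1]exprS.
by rewrite le_eqVlt; apply/orP; left; apply/eqP; ring.
Qed.

(** Counts the terms of the union bound below. *)
Lemma card_fix_at c : #|[set g : {perm I} | g c == c]| = (#|I|.-1)`!.
Proof.
have -> : [set g : {perm I} | g c == c] = [set g | perm_on (~: [set c]) g].
  apply/setP => g; rewrite !inE; apply/eqP/subsetP => [gc y|H].
    by rewrite !inE; apply: contra => /eqP ->; rewrite gc.
  by apply/eqP/negPn/negP => gc; have := H c gc; rewrite !inE eqxx.
rewrite cardsE card_perm; congr (_`!).
by have := cardsC [set c]; rewrite cards1 => <-.
Qed.

(** Union bound: a uniform permutation fixes [#|A| / #|I| = 1/2] cards of [A] on average. *)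
Lemma sum_nofix_ge : (2 * #|A| = #|I|)%N -> (0 < #|I|)%N ->
  #|I|`!%:R / 2 <= \sum_g nofix g.
Proof.
move=> cA I0.
have : \sum_(g : {perm I}) (1 - nofix g) <= \sum_(g : {perm I}) \sum_(c in A) (g c == c)%:R.
  apply: ler_sum => g _; rewrite /nofix; case: (boolP (deranges g)) => [_|].
    by rewrite subrr; apply: sumr_ge0 => c _; apply: ler0n.
  rewrite negb_forall subr0 => /existsP[c]; rewrite negb_imply negbK => /andP[cA' gc].
  rewrite (bigD1 c) //= gc lerDl; apply: sumr_ge0 => d _; apply: ler0n.
rewrite exchange_big /= sumrB sumr_const.
have -> : \sum_(c in A) \sum_(g : {perm I}) (g c == c)%:R = #|I|`!%:R / 2 :> R.
  transitivity (\sum_(c in A) ((#|I|.-1)`!%:R : R)).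
    apply: eq_bigr => c _; rewrite -(card_fix_at c) -sum1_card natr_sum [RHS]big_mkcond.
    by apply: eq_bigr => g _; rewrite inE; case: eqP.
  have fE : #|I|`! = (#|I| * (#|I|.-1)`!)%N by case: #|I| I0 => // m _; rewrite factS.
  have NA : #|I|%:R = 2 * #|A|%:R :> R by rewrite -cA natrM.
  by rewrite sumr_const -mulr_natr fE natrM NA; field.
have -> : #|{: {perm I}}| = #|I|`!.
  have := card_perm [set: I]; rewrite cardsT => <-; apply: eq_card => g; rewrite !inE.
  by apply/esym/subsetP => y; rewrite inE.
lra.
Qed.

(** The event of fixing no a-card has probability at least [(1 - eps) / 2] by separation and at most
    [1 / mu] by Chebyshev, with [mu] the mean number of untouched a-cards. *)
Lemma sep_lower_bound t eps : (2 * #|A| = #|I|)%N -> (0 < #|I|)%N -> 0 < e -> 2 * e < 1 ->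
  (forall g, (1 - eps) / #|I|`!%:R <= iter t (walk p) (@dirac R I) g) -> eps < 1 ->
  (1 - eps) / 2 <= (#|A|%:R * ((1 - e) ^+ 2) ^+ t)^-1.
Proof.
move=> cA I0 e0 e1 H eps1.
have A0 : 0 < #|A|%:R :> R by rewrite ltr0n; lia.
set q1 := (1 - e) ^+ 2; set q2 := (1 - 2 * e) ^+ 2.
have q10 : 0 < q1 ^+ t by rewrite !exprn_gt0 //; lra.
pose mu := #|A|%:R * q1 ^+ t.
have mu0 : 0 < mu by apply: mulr_gt0.
have f0 := fact_gt0R R #|I|.
have L : (1 - eps) / 2 <= \sum_g iter t (walk p) (@dirac R I) g * nofix g.
  apply: le_trans (_ : \sum_(g : {perm I}) (1 - eps) / #|I|`!%:R * nofix g <= _).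
    rewrite -mulr_sumr -mulrA; apply: ler_wpM2l; first by lra.
    by rewrite mulrC ler_pdivlMr // mulrC; apply: sum_nofix_ge.
  by apply: ler_sum => g _; apply: ler_wpM2r => //; apply: ler0n.
apply: le_trans L _; rewrite iter_walk_selfadj (bigD1 1%g) //= big1 => [|g /negPf gn]; last first.
  by rewrite /dirac gn mul0r.
rewrite /dirac eqxx mul1r addr0.
apply: le_trans (@nofix_le mu t A 1%g mu0 (subxx _) _) _; first by move=> c _; rewrite perm1.
(* As [1 - 2 * e <= (1 - e) ^+ 2], untouched cards are not positively correlated and the variance is
   at most the mean. *)
have q21 : q2 <= q1 ^+ 2.
  rewrite /q1 /q2; apply: lerXn2r; rewrite ?nnegrE ?sqr_ge0 //; first by lra.
  have := sqr_ge0 e; rewrite !expr2; lra.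
have q2t : q2 ^+ t <= (q1 ^+ t) ^+ 2.
  by rewrite exprAC; apply: lerXn2r; rewrite ?nnegrE ?sqr_ge0.
rewrite /chebyshev -/q1 -/q2 -/mu.
have -> : 1 - 2 * q1 ^+ t * #|A|%:R / mu + (q1 ^+ t * #|A|%:R + q2 ^+ t * (#|A|%:R * (#|A|%:R - 1))) / mu ^+ 2
  = mu^-1 + ((#|A|%:R - 1) * q2 ^+ t / (#|A|%:R * (q1 ^+ t) ^+ 2) - 1).
  rewrite /mu; field; rewrite !lt0r_neq0 //.
rewrite gerDl subr_le0 ler_pdivrMr ?mul1r; last by rewrite mulr_gt0 // exprn_gt0.
have A1 : 1 <= #|A|%:R :> R by rewrite ler1n -(ltr0n R).
apply: ler_pM => //; rewrite ?exprn_ge0 ?sqr_ge0 //; lra.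
Qed.

End Untouched.

(** * The separation mixing time *)

Local Notation Rt := Rdefinitions.R.

Lemma IZR2 : IZR 2 = 2%:R :> Rt.
Proof. by rewrite IZRposE INRE. Qed.

Lemma pickE n (A : {set 'I_(2 * n)}) (a : Rt) c : Defs.pick A a c = bias A a c.
Proof. by rewrite /Defs.pick /weight /bias RdivE INRE card_ord; case: ifP => // _; rewrite RminusE IZR2. Qed.

(** For given hands an arrangement has exactly one predecessor, so the sum over [s0] collapses. *)
Lemma PtE n (A : {set 'I_(2 * n)}) (a : Rt) t g :
  Pt A a t g = iter t (walk (bias A a)) (@dirac Rt _) g.
Proof.
elim: t g => [|t IH] g; first by rewrite /= /dirac; case: eqP.
rewrite iterS -(eq_walk _ IH).
transitivity (\sum_(s0 : {perm 'I_(2 * n)}) \sum_r \sum_l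
   (if step s0 r l == g then Pt A a t s0 * Defs.pick A a r * Defs.pick A a l else 0)) => //.
rewrite exchange_big; apply: eq_bigr => r _ /=.
rewrite exchange_big; apply: eq_bigr => l _ /=.
rewrite (bigD1 (tperm r l * g)%g) //= big1 => [|s0 sn]; last first.
  case: eqP => // E; case/eqP: sn; rewrite -E /step mulgA tperm2 mul1g //.
by rewrite /step mulgA tperm2 mul1g eqxx addr0 !pickE; ring.
Qed.

Lemma scale_bounds n (k := (2 * n %/ 32)%N) : (32 <= n)%N ->
  [/\ (1 < k)%N, (32 * k <= 2 * n)%N & (2 * n <= 64 * k)%N].
Proof. by move=> n32; rewrite /k; split; lia. Qed.

Section Mixing.
Variables (a eps : Rt) (A : forall n, {set 'I_(2 * n)}).
Hypotheses (a0 : 0 < a) (a1 : a <= 1) (hA : forall n, #|A n| = n).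
Hypotheses (e0 : 0 < eps) (e1 : eps < 1).

Lemma sep_okP n t : sep_ok (A n) a eps t <->
  forall g, (1 - eps) / #|'I_(2 * n)|`!%:R <= iter t (walk (bias (A n) a)) (@dirac Rt _) g.
Proof.
split=> H g; have := H g.
  by rewrite PtE card_ord => /Rge_le /RleP; rewrite RdivE INRE.
by rewrite card_ord => /RleP ?; apply: Rle_ge; rewrite PtE RdivE INRE.
Qed.

Lemma sep_ok_ex n : exists t, sep_ok (A n) a eps t.
Proof.
have [ha0 ha1 he0 he1] := And4 a0 a1 e0 e1.
case: (posnP n) => [->|n0].
  exists 0%N; apply/sep_okP => g; rewrite card_ord /=.
  have -> : g = 1%g by apply/permP => -[].
  have h : 1 - eps <= 1 by lra.
  by rewrite /dirac eqxx [(_`!)](_ : _ = 1%N) // divr1.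
have cI : #|'I_(2 * n)| = (2 * n)%N by rewrite card_ord.
set N := #|'I_(2 * n)|%:R : Rt.
have N1 : 1 <= N by rewrite ler1n cI muln_gt0.
have N2 : 0 < N ^+ 2 by rewrite exprn_gt0 //; lra.
have a3 : 0 < a ^+ 3 by rewrite exprn_gt0.
have a31 : a ^+ 3 <= 1 by rewrite exprn_ile1 // ltW.
have N21 : 1 <= N ^+ 2 by rewrite exprn_ege1.
have y0 : 0 <= 1 - a ^+ 3 / N ^+ 2.
  by rewrite subr_ge0 ler_pdivrMr // mul1r; lra.
have y1 : 1 - a ^+ 3 / N ^+ 2 < 1 by rewrite gtrBl divr_gt0.
have [||s Hs] := @pow_small (1 - a ^+ 3 / N ^+ 2) (eps / N ^+ 2).
- by split; [apply/RleP | apply/RltP].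
- by apply/RltP; rewrite divr_gt0.
exists s; apply/sep_okP => g; apply: le_trans (biased_sep_weak n0 cI (hA n) ha0 ha1 s g).
apply: ler_wpM2r; first by rewrite invr_ge0 ler0n.
move/RleP: Hs; rewrite RpowE ler_pdivlMr // -/N => Hs; lra.
Qed.

Lemma ex_sep_mixing_time n : exists T, is_sep_mixing_time (A n) a eps T.
Proof.
have [t Ht] := sep_ok_ex n.
have ex : exists t, `[< sep_ok (A n) a eps t >] by exists t; apply/asboolP.
case: (ex_minnP ex) => T /asboolP HT Hmin.
exists T; split=> // t' Ht'; apply/ssrnat.leP/Hmin; exact/asboolP.
Qed.

Lemma ge_nat (X : Rt) : exists n0 : nat, forall n, (n0 <= n)%N -> Rle X (INR (2 * n)).
Proof.
have [n0 Hn0] := INR_unbounded X.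
exists n0 => n nn.
apply: Rle_trans (_ : Rle (INR n0) _); first exact: Rlt_le Hn0.
by apply: le_INR; apply/ssrnat.leP; lia.
Qed.

Lemma sep_upper (eta : Rt) : 0 < eta -> eta <= 1 -> exists n0 : nat, forall n, (n0 <= n)%N ->
  exists2 t, sep_ok (A n) a eps t &
    Rle (INR t) (Rdiv (Rmult (Rplus 1 eta) (Rmult (INR (2 * n)) (ln (INR (2 * n))))) (Rmult 2 a)).
Proof.
move=> h0 h1; have [ha0 ha1 he0 he1] := And4 a0 a1 e0 e1.
have eps2 : 0 < eps / 2 by lra.
have a2 : 0 < a ^+ 2 by rewrite exprn_gt0.
have a21 : a ^+ 2 <= 1 by rewrite exprn_ile1 // ltW.
(* [W] sets the length of an attempt and [K] the number of attempts. Neither depends on [n], so all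
   attempts together take [B * x] steps. *)
have [W HW] : exists W : nat, (1 - a ^+ 2 / 2) ^+ W <= (2 ^+ 9)^-1 :> Rt.
  have r0 : 0 <= 1 - a ^+ 2 / 2 by lra.
  have r1 : 1 - a ^+ 2 / 2 < 1 by lra.
  have [||W HW] := @pow_small (1 - a ^+ 2 / 2) ((2 ^+ 9)^-1).
  - by split; [apply/RleP | apply/RltP].
  - by apply/RltP; rewrite invr_gt0 exprn_gt0.
  by exists W; move/RleP: HW; rewrite RpowE.
have [K HK] : exists K : nat, (1 - a ^+ 2 / 64%:R / 128%:R) ^+ K <= eps / 2 :> Rt.
  have r0 : 0 <= 1 - a ^+ 2 / 64%:R / 128%:R by lra.
  have r1 : 1 - a ^+ 2 / 64%:R / 128%:R < 1 by lra.
  have [||K HK] := @pow_small (1 - a ^+ 2 / 64%:R / 128%:R) (eps / 2).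
  - by split; [apply/RleP | apply/RltP].
  - exact/RltP.
  by exists K; move/RleP: HK; rewrite RpowE.
(* The loss [d] in the contraction rate is the [eta / 4] of the time budget, and
   [d * C = d + 1 >= 1 - a]. *)
pose d := eta / 4%:R; pose C := 1 + d^-1.
have d0 : 0 < d by rewrite /d; lra.
have di0 : 0 < d^-1 by rewrite invr_gt0.
have C1 : 1 <= C by rewrite /C; lra.
have dC : 1 - a <= d * C by rewrite /C mulrDr mulr1 divff ?lt0r_neq0 //; lra.
have d1 : d <= 1 by rewrite /d; lra.
pose B := (K * (W + 1))%:R : Rt.
have RP (x y : Rt) : x <= y -> Rle x y by move/RleP.
have RS (x y : Rt) : x < y -> Rlt x y by move/RltP.
have [] := @upper_numeric a (eps / 2) eta B C (conj (RS _ _ ha0) (RP _ _ ha1)) _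
  (conj (RS _ _ h0) (RP _ _ h1)) _ _.
- exact: RS.
- by apply: RP; apply: ler0n.
- by apply: RS; apply: lt_le_trans C1; apply: ltr01.
(* The bound [64 * 128 / a] forces [a * k >= 128], hence [2 * N <= 128 * k <= a * k^2]. *)
move=> X HX; have [n1 Hn1] := ge_nat X; have [n2 Hn2] := ge_nat (64%:R * 128%:R / a).
exists (maxn 32 (maxn n1 n2)) => n; rewrite !geq_max => /and3P[n32 nn1 nn2].
have {}Hn1 := Hn1 n nn1; have /RleP {}Hn2 := Hn2 n nn2.
have [s [Hs1 Hs2]] := HX _ Hn1.
have n0 : (0 < n)%N by apply: leq_trans n32.
have cI : #|'I_(2 * n)| = (2 * n)%N by rewrite card_ord.
set x := INR (2 * n) in Hn1 Hn2 Hs1 Hs2 *.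
have xE : x = #|'I_(2 * n)|%:R by rewrite /x INRE cI.
pose k := (2 * n %/ 32)%N.
have [k1 kN Nk] := scale_bounds n32; rewrite -/k -cI in k1 kN Nk.
have x2 : 2 <= x by rewrite xE ler_nat cI leq_pmulr.
have xk : x <= 64%:R * k%:R by rewrite xE -natrM ler_nat.
have kk : 2 * #|'I_(2 * n)|%:R <= a * k%:R ^+ 2 :> Rt.
  rewrite -xE; have k128 : 128%:R <= a * k%:R :> Rt.
    have : 64%:R * 128%:R / a <= 64%:R * k%:R by apply: le_trans xk.
    by rewrite ler_pdivrMr // => ?; lra.
  rewrite expr2 mulrA; apply: le_trans (_ : 128%:R * k%:R <= _); first by lra.
  by apply: ler_wpM2r => //; apply: ler0n.
exists (K * (W * #|'I_(2 * n)| + #|'I_(2 * n)|) + s)%N; last first.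
  have -> : INR (K * (W * #|'I_(2 * n)| + #|'I_(2 * n)|) + s) = Rplus (Rmult B x) (INR s) => //.
  by rewrite !INRE natrD /B xE RplusE RmultE -natrM; congr (_%:R + _); rewrite -mulnA mulnDl mul1n.
pose y := 2 * a * (1 - d) / x.
have y01 : 0 <= y <= 1.
  have h : a * (1 - d) <= 1 * 1 by apply: ler_pM => //; lra.
  have h' : 0 <= a * (1 - d) by apply: mulr_ge0; lra.
  rewrite /y divr_ge0 /= ?ler_pdivrMr ?mul1r; lra.
have Hs : (1 - y) ^+ s * (64%:R * C * x) <= eps / 2.
  have := @pow_le_exp y s; case/andP: y01 => /RleP ya /RleP yb /(_ (conj ya yb)) /RleP.
  rewrite RpowE => Hp; move/RleP: Hs1.
  have I4 : IZR 4 = 4%:R :> Rt by rewrite IZRposE INRE.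
  have I64 : IZR 64 = 64%:R :> Rt by rewrite IZRposE INRE.
  rewrite !(RdivE, RmultE, RminusE, RoppE) IZR2 I4 I64.
  apply: le_trans; apply: ler_wpM2r; last exact: Hp.
  by rewrite !mulr_ge0 ?ler0n //; lra.
apply/sep_okP => g.
have z0 : 0 <= (1 - a ^+ 2 / 64%:R / 128%:R) ^+ K :> Rt by rewrite exprn_ge0 //; lra.
have w0 : 0 <= (1 - y) ^+ s * (64%:R * C * x).
  by rewrite !mulr_ge0 ?ler0n ?exprn_ge0 //; case/andP: y01 => ? ?; lra.
apply: le_trans (@biased_sep_le _ _ (A n) n a n0 cI (hA n) ha0 ha1 C d C1 (ltW d0) dC s K W k g
   d1 k1 kN Nk kk HW _); rewrite -!xE -/y; last by lra.
rewrite mulrA; apply: ler_wpM2r; first by rewrite invr_ge0 ler0n.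
move: ((1 - a ^+ 2 / 64%:R / 128%:R) ^+ K) HK z0 => z HK z0.
move: ((1 - y) ^+ s * (64%:R * C * x)) Hs w0 => w Hs w0.
(* Two errors of at most [eps / 2] each: [(1 - z) (1 - w) >= 1 - eps]. *)
have : 0 <= z * w by apply: mulr_ge0.
rewrite mulrBl !mulrBr; lra.
Qed.

Lemma sep_lower (eta : Rt) : 0 < eta -> eta <= 1 -> exists n0 : nat, forall n t, (n0 <= n)%N ->
  sep_ok (A n) a eps t ->
  Rlt (Rdiv (Rmult (Rminus 1 eta) (Rmult (INR (2 * n)) (ln (INR (2 * n))))) (Rmult 2 a)) (INR t).
Proof.
move=> h0 h1; have [ha0 ha1 he0 he1] := And4 a0 a1 e0 e1.
have RP (x y : Rt) : x <= y -> Rle x y by move/RleP.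
have RS (x y : Rt) : x < y -> Rlt x y by move/RltP.
have e3 : 0 < 1 - eps by lra.
have c0 : 0 < 2 / (1 - eps) by rewrite divr_gt0.
(* A mean number of untouched a-cards above [2 / (1 - eps)] contradicts
   [(1 - eps) / 2 <= 1 / mu]. *)
have [] := @lower_numeric a eta (2 / (1 - eps)) (conj (RS _ _ ha0) (RP _ _ ha1))
  (conj (RS _ _ h0) (RP _ _ h1)).
  exact: RS.
move=> X HX; have [n1 Hn1] := ge_nat X.
exists (maxn 2 n1) => n t; rewrite !geq_max => /andP[n2 nn1] /sep_okP Hsep.
have {}Hn1 := Hn1 n nn1.
apply: Rnot_le_lt => Ht; have := HX _ t Hn1 Ht.
have n0 : (0 < n)%N by apply: leq_trans n2.
have cI : #|'I_(2 * n)| = (2 * n)%N by rewrite card_ord.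
have xE : INR (2 * n) = 2 * n%:R by rewrite INRE natrM.
have nR : 2 <= n%:R :> Rt by rewrite ler_nat.
pose e := a / #|'I_(2 * n)|%:R.
have eE : e = a / (2 * n%:R) by rewrite /e cI natrM.
have ee0 : 0 < e by rewrite eE divr_gt0 //; lra.
have e12 : 2 * e < 1.
  by rewrite eE mulrA ltr_pdivrMr; lra.
have pA i : i \in A n -> bias (A n) a i = e by move=> iA; rewrite /bias iA.
have := @sep_lower_bound _ _ (bias (A n) a) (A n) e (distr_bias n0 cI (hA n) ha0 ha1) pA t eps _ _ ee0 e12 Hsep he1.
rewrite hA cI => /(_ erefl); rewrite muln_gt0 n0 => /(_ erefl) => H /RltP.
rewrite RpowE !(RdivE, RmultE, RminusE) IZR2 xE -eE multE exprM => H'.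
have q0 : 0 < n%:R * ((1 - e) ^+ 2) ^+ t :> Rt.
  by rewrite mulr_gt0 ?exprn_gt0 //; lra.
move: H H'.
have -> : 2 * n%:R / 2 * ((1 - e) ^+ 2) ^+ t = n%:R * ((1 - e) ^+ 2) ^+ t :> Rt by field.
move: (n%:R * _) q0 => z z0 H.
rewrite ltNge => /negP; apply.
move: H; rewrite -(ler_pM2r z0) mulVf ?lt0r_neq0 // => H.
rewrite ler_pdivlMr //.
have H2 : z * (1 - eps) <= 2 by lra.
exact: H2.
Qed.

End Mixing.

Lemma mixing_time_limit
  (a : Rt) (ha0 : Rlt 0 a) (ha1 : Rle a 1)
  (A : forall n : nat, {set 'I_(2 * n)})
  (hA : forall n : nat, #|A n| = n)
  (eps : Rt) (he0 : Rlt 0 eps) (he1 : Rlt eps 1) :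
  exists T : nat -> nat,
    (forall n : nat, is_sep_mixing_time (A n) a eps (T n)) /\
    Un_cv (fun n : nat =>
             Rdiv (Rmult (Rmult 2 a) (INR (T n))) (Rmult (INR (2 * n)) (ln (INR (2 * n))))) 1.
Proof.
move/RltP: ha0 => a0; move/RleP: ha1 => a1; move/RltP: he0 => e0; move/RltP: he1 => e1.
have [T HT] := choice (ex_sep_mixing_time a0 a1 hA e0 e1).
exists T; split=> // ep /Rgt_lt /RltP ep0.
pose eta := Num.min (ep / 2) 1.
have eta0 : 0 < eta by rewrite lt_min ltr01 andbT divr_gt0.
have eta1 : eta <= 1 by rewrite ge_min lexx orbT.
have ep2 : ep / 2 < ep by rewrite gtr_pMr // invf_lt1 ?ltr1n.
have etaep : eta < ep by apply: le_lt_trans ep2; rewrite ge_min lexx.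
have [n1 H1] := sep_upper a0 a1 hA e0 e1 eta0 eta1.
have [n2 H2] := sep_lower a0 a1 hA e0 e1 eta0 eta1.
(* [n >= 1] makes [ln (2 n)] positive. *)
exists (maxn 1 (maxn n1 n2)) => n /ssrnat.leP; rewrite !geq_max => /and3P[n0 nn1 nn2].
have [sepT minT] := HT n.
have [t /minT /le_INR Tt Ht] := H1 n nn1.
have low := H2 n (T n) nn2 sepT.
have up := Rle_trans _ _ _ Tt Ht.
have x1 : Rlt 1 (INR (2 * n)).
  rewrite -[X in Rlt X _]/(INR 1); apply: lt_INR; apply/ssrnat.ltP.
  by rewrite (@leq_mul2l 2 1 n).
have L0 : Rlt 0 (ln (INR (2 * n))) by rewrite -ln_1; apply: ln_increasing => //; exact: Rlt_0_1.
move/RltP: etaep => etaep; move/RltP: a0 => a0.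
apply: (@ratio_dist a (INR (T n)) (Rmult (INR (2 * n)) (ln (INR (2 * n)))) eta ep a0 _ low up etaep).
by apply: Rmult_lt_0_compat => //; apply: Rlt_trans x1; exact: Rlt_0_1.
Qed.

Local Close Scope ring_scope.
From Stdlib Require Import Reals.

Theorem mainTheorem1
  (a : R) (ha0 : (0 < a)%R) (ha1 : (a <= 1)%R)
  (A : forall n : nat, {set 'I_(2 * n)})
  (hA : forall n : nat, #|A n| = n)
  (eps : R) (he0 : (0 < eps)%R) (he1 : (eps < 1)%R) :
  exists T : nat -> nat,
    (forall n : nat, is_sep_mixing_time (A n) a eps (T n)) /\
    Un_cv (fun n : nat =>
             (2 * a * INR (T n) / (INR (2 * n) * ln (INR (2 * n))))%R) 1%R.
Proof. exact: mixing_time_limit. Qed.
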